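(* For all real $z>0$, $$\begin{aligned}S_{3,2}(1-e^{2z})+S_{3,2}(1-e^{-2z})&=\left(2\operatorname{Li}_5(1-e^{2z})+2\operatorname{Li}_5(1-e^{-2z})-\operatorname{Li}_5(e^{-2z})\right)\\&\quad-2z\left(\operatorname{Li}_4(1-e^{2z})-\operatorname{Li}_4(1-e^{-2z})\right)+\frac{2z^5}{15}\\&\quad-\frac{2z^4}{3}\log(2\sinh z)+\zeta(5)-2z\zeta(4)+2z^2\zeta(3)-\frac{4z^3}{3}\zeta(2).\end{aligned}$$
   Context: For integers $m,k\ge1$ and $x\in\mathbb{C}\setminus[1,\infty)$ the Nielsen polylogarithm is $$S_{m,k}(x)=\frac{(-1)^{m+k-1}}{(m-1)!\,k!}\int_0^1 \log(t)^{m-1}\log(1-xt)^k\,\frac{dt}{t}$$ with the principal branch of the logarithm. $\operatorname{Li}_m(x)=\sum_{n\ge1}x^n n^{-m}$ for $|x|<1$ is the polylogarithm, extended by analytic continuation to $\mathbb{C}\setminus[1,\infty)$ (principal branch). $\zeta$ is the Riemann zeta function. *)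

(* Defs.v *)
From Stdlib Require Import Reals Factorial ClassicalEpsilon.
From Coquelicot Require Import Coquelicot.
Open Scope R_scope.

(* Principal argument, with values in (-PI, PI]; its value at 0 is junk. *)
Definition Carg (x : C) : R :=
  if Rle_dec 0 (Im x) then acos (Re x / Cmod x) else - acos (Re x / Cmod x).

Definition Clog (x : C) : C := (ln (Cmod x), Carg x).

Definition slit_plane (x : C) : Prop := ~ (Im x = 0 /\ 1 <= Re x).

Definition analytic_on (U : C -> Prop) (f : C -> C) : Prop :=
  forall a : C, U a ->
  exists (c : nat -> C) (r : R), 0 < r /\
    forall x : C, Cmod (x - a)%C < r ->
      @is_pseries C_AbsRing C_NormedModule c (x - a)%C (f x).

Definition is_polylog (m : nat) (L : C -> C) : Prop :=
  analytic_on slit_plane L /\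
  forall x : C, Cmod x < 1 ->
    @is_series C_AbsRing C_NormedModule
      (fun n : nat => (x ^ S n / RtoC (INR (S n)) ^ m)%C) (L x).

(* The analytic continuation of the power series is unique on [slit_plane]
   (which is connected); the values of [polylog m] on the cut [1, +oo) are
   unspecified. *)
Definition polylog (m : nat) : C -> C :=
  epsilon (inhabits (fun _ : C => RtoC 0)) (is_polylog m).

(* Meant for 1 <= m, 1 <= k and x in [slit_plane].  The integral is improper:
   the integrand can be unbounded at t = 0 (when k = 1 and m >= 2). *)
Definition nielsen (m k : nat) (x : C) : C :=
  (RtoC ((-1) ^ (m + k - 1) / (INR (fact (m - 1)) * INR (fact k))) *
   @RInt_gen C_R_CompleteNormedModule
     (fun t : R => RtoC (ln t) ^ (m - 1) * Clog (1 - x * RtoC t) ^ k / RtoC t)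
     (at_right 0) (at_left 1))%C.

(* Riemann zeta function at the integers s >= 2. *)
Definition zeta (s : nat) : R := Series (fun n : nat => / INR (S n) ^ s).

(* Main.v *)
Require Import Defs.
From Stdlib Require Import Reals Lra Lia ClassicalEpsilon.
From Coquelicot Require Import Coquelicot.
Open Scope R_scope.

(** Put [x = 1 - e^(2z)], [y = 1 - e^(-2z)], [w = e^(-2z)] and [c = coth z].
    Then [dx/x = (c + 1) dz], [dy/y = (c - 1) dz] and [dw/w = - 2 dz], while
    the weight-one functions [Li_1] and [log^2 (1 - u)] are polynomials in [z]
    at [x] and [y], and [Li_1 w = z - log (2 sinh z)].  Every function in the
    formula is an iterated integral against [du/u], so differentiating in [z]
    lowers its weight by one.

    The derivative of the difference of the two sides has the form
    [c A + B], where [A] and [B] are combinations of the same kind, one weight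
    lower.  Both vanish for the same reason, and going down ends with Landen's
    equation [Li_2 x + Li_2 y = - 2 z^2] and with identities in weight one.
    Each combination is thus constant on [z > 0], and the constant is its limit
    as [z] tends to [0]: there [x] and [y] tend to [0], where iterated integrals
    vanish, [w] tends to [1], where [Li_m] tends to [zeta m], and
    [z log (2 sinh z)] tends to [0].  The chain is [Li2_X_Y], ...,
    [nielsen2_3_X_add_Y].

    This is real analysis on [(-oo, 1)], with iterated integrals produced by
    the averaging operator [avg f x], the integral of [f (x t)] over [0 <= t <= 1],
    since [x * avg f x] is a primitive of [f].  Two bridges lead to it from
    the complex functions.

    The Nielsen integral reduces to [nielsen2 3] by the explicit primitive
    [log_primitive] of its integrand (lemma [nielsen_RtoC]).

    The function [polylog m] is only known as some analytic continuation of
    the power series, so one has to show that a continuation exists and that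
    its values on [(-oo, 1)] are forced.  For existence, start from
    [1 / (1 - u)] and iterate the complex averaging operator [cavg].  Around a
    point [a] of the slit plane, [1 / (1 - x s)] has a Taylor expansion in
    [x - a] whose remainder is bounded uniformly in [0 <= s <= 1]; averaging
    along rays keeps this bound ([expands_cavg]).  Hence analyticity at [a]
    passes to all iterates without any exchange of sums and integrals, and at
    [a = 0] the same computation gives the polylogarithm series.  Uniqueness
    ([analytic_eq_0]) follows by continuation along the negative real axis. *)

(** * Averages over the segment from the origin *)

(** The integral of [f (x t)] over the unit interval rather than [(1/x)] times
    the integral of [f] from [0] to [x], so that the formula also makes sense
    at [x = 0]. *)
Definition avg (f : R -> R) (x : R) : R := RInt (fun t => f (x * t)) 0 1.

Definition continuous_below_1 (f : R -> R) : Prop :=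
  forall x, x < 1 -> continuous f x.

Lemma scaled_lt_1 (x t : R) : x < 1 -> 0 <= t <= 1 -> x * t < 1.
Proof.
  intros x1 [[t0 | <-] t1]; [|lra].
  assert (x * t < 1 * t) by (now apply Rmult_lt_compat_r). lra.
Qed.

Lemma ex_RInt_below_1 (f : R -> R) (a b : R) :
  continuous_below_1 f -> a < 1 -> b < 1 -> ex_RInt f a b.
Proof.
  intros cf a1 b1; apply @ex_RInt_continuous; intros u hu; apply cf.
  assert (h : Rmax a b < 1) by (now apply Rmax_lub_lt). lra.
Qed.

Lemma ex_RInt_scaled (f : R -> R) (x : R) :
  continuous_below_1 f -> x < 1 -> ex_RInt (fun t => f (x * t)) 0 1.
Proof.
  intros cf x1; apply @ex_RInt_continuous; intros t ht.
  rewrite Rmin_left, Rmax_right in ht by lra.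
  apply (continuous_comp (fun t => x * t) f).
  - apply @ex_derive_continuous; auto_derive; trivial.
  - apply cf, scaled_lt_1; lra.
Qed.

Lemma is_RInt_avg (f : R -> R) (x : R) :
  continuous_below_1 f -> x < 1 -> is_RInt f 0 x (x * avg f x).
Proof.
  intros cf x1.
  replace (x * avg f x) with (RInt f 0 x).
  { apply @RInt_correct, ex_RInt_below_1; trivial; lra. }
  pose proof (RInt_comp_lin f x 0 0 1) as e.
  replace (x * 0 + 0) with 0 in e by ring.
  replace (x * 1 + 0) with x in e by ring.
  rewrite <- e by (apply ex_RInt_below_1; trivial; lra).
  rewrite RInt_scal.
  - unfold avg, scal; simpl; unfold mult; simpl; f_equal.
    apply RInt_ext; intros t _; f_equal; ring.
  - apply (ex_RInt_ext (fun t => f (x * t))).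
    + intros t _; f_equal; ring.
    + now apply ex_RInt_scaled.
Qed.

Lemma locally_below_1 (x : R) : x < 1 -> locally x (fun u => u < 1).
Proof. intros x1; exact (open_lt 1 x x1). Qed.

Lemma is_derive_mul_avg (f : R -> R) (x : R) :
  continuous_below_1 f -> x < 1 -> is_derive (fun u => u * avg f u) x (f x).
Proof.
  intros cf x1; apply (is_derive_RInt f _ 0 x); [|now apply cf].
  generalize (locally_below_1 x x1); apply filter_imp; intros u u1.
  now apply is_RInt_avg.
Qed.

Lemma avg_at_0 (f : R -> R) : avg f 0 = f 0.
Proof.
  unfold avg; rewrite (RInt_ext _ (fun _ => f 0)).
  - rewrite RInt_const; compute; ring.
  - intros t _; f_equal; ring.
Qed.

(** Away from [0], [avg f x] is the quotient of a differentiable function by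
    [x]; at [0] the continuity of [f] bounds [f (x t) - f 0] uniformly in [t]. *)
Lemma avg_continuous (f : R -> R) :
  continuous_below_1 f -> continuous_below_1 (avg f).
Proof.
  intros cf x x1.
  destruct (Req_dec x 0) as [-> | x0].
  - apply filterlim_locally; intros eps.
    pose proof (proj1 (filterlim_locally _ _) (cf 0 Rlt_0_1) (pos_div_2 eps)) as [d hd].
    assert (hm : 0 < Rmin d 1) by (apply Rmin_pos; [apply cond_pos | lra]).
    exists (mkposreal _ hm); intros u hu.
    rewrite avg_at_0.
    unfold ball in hu |- *; simpl in hu |- *; unfold AbsRing_ball in hu |- *.
    unfold abs, minus, plus, opp in hu |- *; simpl in hu |- *.
    rewrite Ropp_0, Rplus_0_r in hu.
    assert (hu1 : Rabs u < d) by (eapply Rlt_le_trans; [exact hu | apply Rmin_l]).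
    assert (hu2 : u < 1).
    { apply Rle_lt_trans with (1 := Rle_abs u). eapply Rlt_le_trans; [exact hu | apply Rmin_r]. }
    apply Rle_lt_trans with (eps / 2); [|pose proof (cond_pos eps); lra].
    apply (norm_RInt_le (fun t => f (u * t) - f 0) (fun _ => eps / 2) 0 1); [lra | | |].
    + intros t ht. apply Rlt_le, hd.
      unfold ball; simpl; unfold AbsRing_ball, abs, minus, plus, opp; simpl.
      rewrite Ropp_0, Rplus_0_r, Rabs_mult, (Rabs_pos_eq t) by lra.
      pose proof (Rabs_pos u); nra.
    + apply (is_RInt_minus (fun t => f (u * t)) (fun _ => f 0)).
      * apply @RInt_correct, ex_RInt_scaled; trivial.
      * generalize (is_RInt_const 0 1 (f 0)); unfold scal; simpl; unfold mult; simpl.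
        now replace ((1 - 0) * f 0) with (f 0) by ring.
    + generalize (is_RInt_const 0 1 (eps / 2)); unfold scal; simpl; unfold mult; simpl.
      now replace ((1 - 0) * (eps / 2)) with (eps / 2) by ring.
  - apply (continuous_ext_loc _ (fun u => (u * avg f u) / u)).
    + assert (h : locally x (fun u => u <> 0)).
      { destruct (Rlt_or_le x 0).
        - generalize (open_lt 0 x H); apply filter_imp; intros; lra.
        - generalize (open_gt 0 x ltac:(lra)); apply filter_imp; intros; lra. }
      revert h; apply filter_imp; intros u hu; change (@eq R (u * avg f u / u) (avg f u)); field; trivial.
    + apply (continuous_mult (fun u => u * avg f u) (fun u => / u)).
      * apply (ex_derive_continuous (V := R_NormedModule) (fun u => u * avg f u)).
        exists (f x); apply is_derive_mul_avg; trivial.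
      * apply @ex_derive_continuous; auto_derive; trivial.
Qed.

(** * Iterated integrals against du/u *)

(** For [j > 0] this is the integral of [iter_int f (j - 1) u / u] from [0] to
    [x], and [iter_int f 0 u = u f u]. The form with [avg] avoids the
    removable singularity at [u = 0]. *)
Definition iter_int (f : R -> R) (j : nat) (x : R) : R := x * Nat.iter j avg f x.

Lemma iter_avg_continuous (f : R -> R) (j : nat) :
  continuous_below_1 f -> continuous_below_1 (Nat.iter j avg f).
Proof.
  intros cf; induction j as [|j ih]; [trivial | now apply avg_continuous].
Qed.

Lemma iter_int_0 (f : R -> R) (j : nat) : iter_int f j 0 = 0.
Proof. apply Rmult_0_l. Qed.

Lemma is_derive_iter_int (f : R -> R) (j : nat) (x : R) :
  continuous_below_1 f -> x < 1 ->
  is_derive (iter_int f (S j)) x (Nat.iter j avg f x).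
Proof.
  intros cf x1; apply is_derive_mul_avg; trivial. now apply iter_avg_continuous.
Qed.

Lemma iter_int_continuous (f : R -> R) (j : nat) :
  continuous_below_1 f -> continuous_below_1 (iter_int f j).
Proof.
  intros cf x x1; apply (continuous_mult (fun u => u) (Nat.iter j avg f)).
  - apply continuous_id.
  - now apply iter_avg_continuous.
Qed.

Definition geom (u : R) : R := / (1 - u).

Lemma geom_continuous : continuous_below_1 geom.
Proof.
  intros x x1; apply @ex_derive_continuous; unfold geom; auto_derive; lra.
Qed.

(** [Li m] is the polylogarithm on [(-oo, 1)] for every [m]: in particular [Li
    0 x = x / (1 - x)]. *)
Definition Li : nat -> R -> R := iter_int geom.

Lemma eq_of_derive_below_1 (f g df : R -> R) :
  (forall x, x < 1 -> is_derive f x (df x)) ->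
  (forall x, x < 1 -> is_derive g x (df x)) ->
  f 0 = g 0 -> forall x, x < 1 -> f x = g x.
Proof.
  intros hf hg h0 x x1.
  assert (hd : forall u, u < 1 -> is_derive (fun v => minus (f v) (g v)) u zero).
  { intros u u1. pose proof (is_derive_minus f g u _ _ (hf u u1) (hg u u1)) as e.
    now rewrite minus_eq_zero in e. }
  enough (e : minus (f x) (g x) = minus (f 0) (g 0)).
  { rewrite h0 in e; unfold minus, plus, opp in e; simpl in e; lra. }
  destruct (Rtotal_order x 0) as [l | [-> | l]]; trivial.
  - apply (eq_is_derive (fun v => minus (f v) (g v))); trivial.
    intros; apply hd; lra.
  - symmetry; apply (eq_is_derive (fun v => minus (f v) (g v))); trivial.
    intros; apply hd; lra.
Qed.

Lemma Li_1 (x : R) : x < 1 -> Li 1 x = - ln (1 - x).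
Proof.
  apply (eq_of_derive_below_1 (Li 1) (fun v => - ln (1 - v)) geom).
  - intros u u1; apply (is_derive_iter_int geom 0 u); [apply geom_continuous | trivial].
  - intros u u1; unfold geom; auto_derive; [lra | field; lra].
  - unfold Li; rewrite iter_int_0, Rminus_0_r, ln_1; ring.
Qed.

(** For [u < 1] this is [log (1 - u) ^ 2 / (2 u)], because [u * avg geom u = -
    log (1 - u)]; written without division by [u] so that continuity at [0] is
    immediate. *)
Definition log_sq_kernel (u : R) : R := u * avg geom u ^ 2 / 2.

Lemma log_sq_kernel_continuous : continuous_below_1 log_sq_kernel.
Proof.
  intros x x1; unfold log_sq_kernel.
  assert (h : continuous (avg geom) x) by (apply avg_continuous; [apply geom_continuous | trivial]).
  apply (continuous_ext (fun u => u * (avg geom u * avg geom u) * / 2)).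
  { intros u; simpl; unfold Rdiv; ring. }
  apply (continuous_mult (fun u => u * (avg geom u * avg geom u)) (fun _ => / 2));
    [|apply continuous_const].
  apply (continuous_mult (fun u => u) (fun u => avg geom u * avg geom u));
    [apply continuous_id|].
  now apply (continuous_mult (avg geom) (avg geom)).
Qed.

(** The Nielsen polylogarithm [S_{j,2}] on [(-oo, 1)]. *)
Definition nielsen2 : nat -> R -> R := iter_int log_sq_kernel.

Lemma nielsen2_0 (x : R) : x < 1 -> nielsen2 0 x = ln (1 - x) ^ 2 / 2.
Proof.
  intros x1; replace (ln (1 - x)) with (- Li 1 x) by (rewrite Li_1; trivial; ring).
  unfold nielsen2, Li, iter_int; simpl; unfold log_sq_kernel; field.
Qed.

(** Chain rule for [du/u]: only the logarithmic derivative [k] of [phi]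
    enters. *)
Lemma is_derive_iter_int_comp (f phi : R -> R) (j : nat) (z dphi k : R) :
  continuous_below_1 f -> phi z < 1 -> is_derive phi z dphi -> dphi = k * phi z ->
  is_derive (fun v => iter_int f (S j) (phi v)) z (iter_int f j (phi z) * k).
Proof.
  intros cf p1 hphi ->; unfold iter_int at 2.
  replace (phi z * Nat.iter j avg f (phi z) * k)
    with (scal (k * phi z) (Nat.iter j avg f (phi z)))
    by (unfold scal; simpl; unfold mult; simpl; ring).
  apply (is_derive_comp (iter_int f (S j)) phi); trivial.
  now apply is_derive_iter_int.
Qed.

(** * One-sided limits at the origin *)

Definition tends (f : R -> R) (l : R) : Prop := filterlim f (at_right 0) (locally l).

Lemma tends_const c : tends (fun _ => c) c.
Proof. apply filterlim_const. Qed.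

Lemma tends_id : tends (fun z => z) 0.
Proof. intros P [e he]; exists e; intros y hy _; now apply he. Qed.

Lemma tends_plus f g a b : tends f a -> tends g b -> tends (fun z => f z + g z) (a + b).
Proof. intros hf hg; eapply filterlim_comp_2; [exact hf | exact hg | apply (filterlim_plus a b)]. Qed.

Lemma tends_mult f g a b : tends f a -> tends g b -> tends (fun z => f z * g z) (a * b).
Proof. intros hf hg; eapply filterlim_comp_2; [exact hf | exact hg | apply (filterlim_mult a b)]. Qed.

Lemma tends_opp f a : tends f a -> tends (fun z => - f z) (- a).
Proof. intros hf; eapply filterlim_comp; [exact hf | apply (filterlim_opp a)]. Qed.

Lemma tends_minus f g a b : tends f a -> tends g b -> tends (fun z => f z - g z) (a - b).
Proof. intros hf hg; apply tends_plus; trivial. now apply tends_opp. Qed.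

Lemma tends_div f c a : tends f a -> tends (fun z => f z / c) (a / c).
Proof. intros hf; apply tends_mult; trivial. apply tends_const. Qed.

Lemma tends_pow f a n : tends f a -> tends (fun z => f z ^ n) (a ^ n).
Proof.
  intros hf; induction n as [|n ih]; [apply tends_const | now apply tends_mult].
Qed.

Lemma tends_continuous f (g : R -> R) a : tends g a -> continuous f a -> tends (fun z => f (g z)) (f a).
Proof. intros hg hf; eapply filterlim_comp; [exact hg | exact hf]. Qed.

Lemma tends_eq (f : R -> R) (a b : R) : tends f a -> a = b -> tends f b.
Proof. now intros h <-. Qed.

(** The bound is only asked on [(0, 1)], where logarithms have a known sign. *)
Lemma tends_squeeze f g : (forall z, 0 < z < 1 -> Rabs (f z) <= g z) -> tends g 0 -> tends f 0.
Proof.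
  intros h hg. apply filterlim_locally; intros eps.
  pose proof (proj1 (filterlim_locally _ _) hg eps) as [d hd].
  assert (hm : 0 < Rmin d 1) by (apply Rmin_pos; [apply cond_pos | lra]).
  exists (mkposreal _ hm); intros u hu u0.
  assert (hu' : Rabs (u - 0) < Rmin d 1) by exact hu.
  rewrite Rminus_0_r, Rabs_pos_eq in hu' by lra.
  pose proof (Rmin_l d 1); pose proof (Rmin_r d 1).
  specialize (hd u). change (Rabs (f u - 0) < eps). rewrite Rminus_0_r.
  apply Rle_lt_trans with (g u); [apply h; lra|].
  apply Rle_lt_trans with (1 := Rle_abs _).
  rewrite <- (Rminus_0_r (g u)); apply hd; trivial.
  change (Rabs (u - 0) < d); rewrite Rminus_0_r, Rabs_pos_eq; lra.
Qed.

(** With [q] the fourth root of [t], [ln t = 4 ln q] and [- ln q <= 1/q - 1].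
    The power [1/4] is small enough for the square of the logarithm to be
    absorbed by [t]. *)
Lemma abs_ln_le (t : R) : 0 < t < 1 -> Rabs (ln t) * sqrt (sqrt t) <= 4.
Proof.
  intros ht. set (q := sqrt (sqrt t)).
  assert (q0 : 0 < q) by (now repeat apply sqrt_lt_R0).
  assert (e : t = q ^ 4).
  { replace (q ^ 4) with ((q * q) * (q * q)) by ring; unfold q.
    rewrite !sqrt_sqrt; try apply sqrt_pos; lra. }
  assert (l : ln t <= 0) by (rewrite <- ln_1; apply Rlt_le, ln_increasing; lra).
  rewrite Rabs_left1 by trivial. rewrite e, ln_pow by trivial.
  pose proof (exp_ineq1_le (- ln q)) as h. rewrite exp_Ropp, exp_ln in h by trivial.
  apply Rmult_le_compat_r with (r := q) in h; [|lra].
  rewrite Rinv_l in h by lra. simpl INR. nra.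
Qed.

Lemma tends_sqrt : tends sqrt 0.
Proof.
  rewrite <- sqrt_0. apply (tends_continuous sqrt (fun z => z)); [apply tends_id|].
  apply continuity_pt_filterlim, continuity_pt_sqrt; lra.
Qed.

Lemma tends_mul_ln_sq : tends (fun t => t * ln t ^ 2) 0.
Proof.
  apply (tends_squeeze _ (fun t => 16 * sqrt t)).
  - intros t ht. pose proof (abs_ln_le t ht) as h.
    assert (a : 0 <= sqrt t) by apply sqrt_pos.
    assert (b : 0 <= sqrt (sqrt t)) by apply sqrt_pos.
    rewrite Rabs_mult, <- RPow_abs, (Rabs_pos_eq t) by lra.
    pose proof (Rabs_pos (ln t)).
    rewrite <- (sqrt_sqrt t) at 1 by lra. rewrite <- (sqrt_sqrt (sqrt t) a) at 1.
    replace (sqrt (sqrt t) * sqrt (sqrt t) * sqrt t * Rabs (ln t) ^ 2)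
      with ((Rabs (ln t) * sqrt (sqrt t)) ^ 2 * sqrt t) by ring.
    apply Rmult_le_compat_r; trivial.
    replace 16 with (4 ^ 2) by ring. apply pow_incr; split; trivial. now apply Rmult_le_pos.
  - eapply tends_eq; [apply tends_mult; [apply tends_const | apply tends_sqrt] | ring].
Qed.

Lemma tends_mul_ln : tends (fun t => t * ln t) 0.
Proof.
  apply (tends_squeeze _ (fun t => 4 * sqrt t)).
  - intros t ht. pose proof (abs_ln_le t ht) as h.
    assert (a : 0 <= sqrt t) by apply sqrt_pos.
    assert (b : 0 <= sqrt (sqrt t)) by apply sqrt_pos.
    assert (c : sqrt (sqrt t) <= 1).
    { rewrite <- sqrt_1; apply sqrt_le_1_alt. rewrite <- sqrt_1; apply sqrt_le_1_alt; lra. }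
    rewrite Rabs_mult, (Rabs_pos_eq t) by lra.
    pose proof (Rabs_pos (ln t)).
    rewrite <- (sqrt_sqrt t) at 1 by lra. rewrite <- (sqrt_sqrt (sqrt t) a) at 1.
    replace (sqrt (sqrt t) * sqrt (sqrt t) * sqrt t * Rabs (ln t))
      with ((Rabs (ln t) * sqrt (sqrt t)) * sqrt (sqrt t) * sqrt t) by ring.
    apply Rmult_le_compat_r; trivial.
    pose proof (Rmult_le_pos _ _ H b); nra.
  - eapply tends_eq; [apply tends_mult; [apply tends_const | apply tends_sqrt] | ring].
Qed.

(** * Differentiation rules *)

(** The differentiation rules are restated with the operations of [R] so that
    they can be applied by matching on the shape of the function, with the
    derivative left to be found and corrected at the end by this lemma. *)
Lemma der_eq (f : R -> R) (z a b : R) : is_derive f z a -> a = b -> is_derive f z b.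
Proof. now intros h <-. Qed.

Lemma der_id z : is_derive (fun v : R => v) z 1.
Proof. apply (is_derive_id z). Qed.

Lemma der_const (c z : R) : is_derive (fun _ : R => c) z 0.
Proof. apply (is_derive_const c z). Qed.

Lemma der_plus (f g : R -> R) (z a b : R) :
  is_derive f z a -> is_derive g z b ->
  is_derive (fun v => f v + g v) z (a + b).
Proof. apply (is_derive_plus f g z a b). Qed.

Lemma der_minus (f g : R -> R) (z a b : R) :
  is_derive f z a -> is_derive g z b ->
  is_derive (fun v => f v - g v) z (a - b).
Proof. apply (is_derive_minus f g z a b). Qed.

Lemma der_mult (f g : R -> R) (z a b : R) :
  is_derive f z a -> is_derive g z b ->
  is_derive (fun v => f v * g v) z (a * g z + f z * b).
Proof. intros hf hg; apply (is_derive_mult f g z a b hf hg). intros; apply Rmult_comm. Qed.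

Lemma der_div (f : R -> R) (c z a : R) :
  is_derive f z a -> is_derive (fun v => f v / c) z (a / c).
Proof.
  intros hf. eapply der_eq; [apply der_mult; [exact hf | apply der_const]|].
  unfold Rdiv; ring.
Qed.

Lemma der_pow (f : R -> R) n (z a : R) :
  is_derive f z a -> is_derive (fun v => f v ^ n) z (INR n * a * f z ^ pred n).
Proof. intros hf; apply is_derive_pow; trivial. Qed.

(** * The Nielsen integral as an iterated integral *)

Lemma is_RInt_RtoC (w : R -> R) (a b l : R) :
  is_RInt w a b l ->
  is_RInt (V := C_R_NormedModule) (fun t => RtoC (w t)) a b (RtoC l).
Proof.
  intros hw; apply (is_RInt_fct_extend_pair (U := R_NormedModule) (V := R_NormedModule) (fun t => RtoC (w t))); simpl; trivial.
  generalize (is_RInt_const (V := R_NormedModule) a b 0).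
  now rewrite (@scal_zero_r R_AbsRing R_NormedModule).
Qed.

Lemma Clog_RtoC (u : R) : 0 < u -> Clog (RtoC u) = RtoC (ln u).
Proof.
  intros hu; unfold Clog, Carg. rewrite Cmod_R, Rabs_pos_eq by lra.
  simpl. destruct (Rle_dec 0 0) as [_ | h]; [|lra].
  rewrite Rdiv_diag, acos_1 by lra. reflexivity.
Qed.

(** The integral over [[a, b]] is [V b - V a], and each end has its own limit;
    a complex integrand enters only through its values on the open interval. *)
Lemma is_RInt_gen_RtoC (f : R -> C) (w V : R -> R) (l0 l1 : R) :
  (forall t, 0 < t < 1 -> f t = RtoC (w t)) ->
  (forall t, 0 < t < 1 -> is_derive V t (w t)) ->
  (forall t, 0 < t < 1 -> continuous w t) ->
  filterlim V (at_right 0) (locally l0) ->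
  filterlim V (at_left 1) (locally l1) ->
  is_RInt_gen (V := C_R_NormedModule) f (at_right 0) (at_left 1) (RtoC (l1 - l0)).
Proof.
  intros hf hV hw h0 h1 P hP.
  assert (hlim : filterlim (fun ab => V (snd ab) - V (fst ab))
            (filter_prod (at_right 0) (at_left 1)) (locally (l1 - l0))).
  { apply (filterlim_comp_2 (F := filter_prod (at_right 0) (at_left 1)) (G := locally l1)
      (H := locally (- l0)) (fun ab => V (snd ab)) (fun ab => - V (fst ab)) Rplus).
    - eapply filterlim_comp; [apply filterlim_snd | exact h1].
    - apply (filterlim_comp _ _ _ (fun ab => V (fst ab)) Ropp _ (locally l0)).
      + eapply filterlim_comp; [apply filterlim_fst | exact h0].
      + apply (filterlim_opp l0).
    - apply (filterlim_plus l1 (- l0)). }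
  assert (hP' : locally (l1 - l0) (fun v => P (RtoC v))).
  { destruct hP as [e he]; exists e; intros v hv; apply he. split; [exact hv | apply ball_center]. }
  specialize (hlim _ hP'); unfold filtermap in hlim.
  assert (hreg : filter_prod (at_right 0) (at_left 1)
     (fun ab => 0 < fst ab < 1 /\ 0 < snd ab < 1)).
  { exists (fun a => 0 < a < 1) (fun b => 0 < b < 1); [| |now simpl].
    - unfold at_right, within; generalize (locally_below_1 0 Rlt_0_1).
      apply filter_imp; intros; lra.
    - unfold at_left, within; generalize (open_gt 0 1 Rlt_0_1).
      apply filter_imp; intros; lra. }
  unfold filtermapi; generalize (filter_and _ _ hlim hreg); apply filter_imp.
  intros [a b]; simpl; intros [hp [ha hb]].
  exists (RtoC (V b - V a)); split; [|exact hp].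
  assert (hin : forall t, Rmin a b <= t <= Rmax a b -> 0 < t < 1).
  { intros t; unfold Rmin, Rmax; destruct (Rle_dec a b); lra. }
  apply (is_RInt_ext (V := C_R_NormedModule) (fun t => RtoC (w t))).
  - intros t ht; symmetry; apply hf, hin; lra.
  - apply is_RInt_RtoC, (is_RInt_derive V w); auto.
Qed.

(** A primitive of [ln t ^ 2 * ln (1 - x t) ^ 2 / t], obtained by integrating
    twice by parts: [nielsen2 0 (x t) = ln (1 - x t) ^ 2 / 2], and each
    integration by parts against [dt/t] raises the index of [nielsen2] and
    lowers the power of [ln t]. *)
Definition log_primitive (x t : R) : R :=
  4 * (ln t ^ 2 / 2 * nielsen2 1 (x * t) - ln t * nielsen2 2 (x * t) + nielsen2 3 (x * t)).

Lemma is_derive_nielsen2_scaled (x t : R) (j : nat) :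
  0 < t -> x * t < 1 ->
  is_derive (fun v => nielsen2 (S j) (x * v)) t (nielsen2 j (x * t) * / t).
Proof.
  intros t0 h; apply (is_derive_iter_int_comp log_sq_kernel (fun v => x * v) j t x); trivial.
  - apply log_sq_kernel_continuous.
  - auto_derive; trivial; ring.
  - field; lra.
Qed.

Lemma is_derive_log_primitive (x t : R) : 0 < t -> x * t < 1 ->
  is_derive (log_primitive x) t (ln t ^ 2 * ln (1 - x * t) ^ 2 / t).
Proof.
  intros t0 h; unfold log_primitive.
  assert (hln : is_derive ln t (/ t)) by (auto_derive; trivial; ring).
  eapply der_eq.
  - apply der_mult; [apply der_const|].
    apply der_plus; [apply der_minus|now apply is_derive_nielsen2_scaled].
    + apply der_mult; [apply der_div, der_pow, hln | now apply is_derive_nielsen2_scaled].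
    + apply der_mult; [exact hln | now apply is_derive_nielsen2_scaled].
  - rewrite (nielsen2_0 (x * t)) by trivial. simpl; field; lra.
Qed.

(** At [t = 1] only the last term of [log_primitive] survives. At [t = 0] each
    [nielsen2 j (x t)] is [x t] times a continuous function, and [t] absorbs
    the logarithms. *)
Lemma nielsen_RtoC (x : R) : x < 1 -> nielsen 3 2 (RtoC x) = RtoC (nielsen2 3 x).
Proof.
  intros x1; unfold nielsen.
  rewrite (is_RInt_gen_unique (V := C_R_CompleteNormedModule) _ (RtoC (4 * nielsen2 3 x - 0))).
  { rewrite <- RtoC_mult; f_equal; simpl; field. }
  assert (hx : forall t, 0 < t <= 1 -> x * t < 1) by (intros; apply scaled_lt_1; lra).
  apply (is_RInt_gen_RtoC _ (fun t => ln t ^ 2 * ln (1 - x * t) ^ 2 / t) (log_primitive x)).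
  - intros t ht. assert (h : x * t < 1) by (apply hx; lra).
    rewrite <- RtoC_mult, <- RtoC_minus, Clog_RtoC by lra.
    rewrite <- !RtoC_pow, <- RtoC_mult, <- RtoC_div by lra. reflexivity.
  - intros t ht; apply is_derive_log_primitive; [lra | apply hx; lra].
  - intros t ht. assert (h : x * t < 1) by (apply hx; lra).
    apply @ex_derive_continuous; auto_derive; lra.
  - apply (filterlim_ext (fun t => 4 * x * (t * ln t ^ 2 * (Nat.iter 1 avg log_sq_kernel (x * t) / 2)
         - t * ln t * Nat.iter 2 avg log_sq_kernel (x * t) + t * Nat.iter 3 avg log_sq_kernel (x * t)))).
    { intros t; unfold log_primitive, nielsen2, iter_int; field. }
    assert (hk : forall j, tends (fun t => Nat.iter j avg log_sq_kernel (x * t)) (Nat.iter j avg log_sq_kernel (x * 0))).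
    { intros j; apply (tends_continuous _ (fun t => x * t)).
      - apply tends_mult; [apply tends_const | apply tends_id].
      - apply iter_avg_continuous; [apply log_sq_kernel_continuous | lra]. }
    eapply tends_eq.
    + apply tends_mult; [apply tends_const|].
      apply tends_plus; [apply tends_minus|]; apply tends_mult.
      * apply tends_mul_ln_sq.
      * apply tends_div, (hk 1%nat).
      * apply tends_mul_ln.
      * apply (hk 2%nat).
      * apply tends_id.
      * apply (hk 3%nat).
    + field.
  - replace (4 * nielsen2 3 x) with (log_primitive x 1).
    + eapply filterlim_filter_le_1; [apply filter_le_within|].
      apply @ex_derive_continuous. eexists; apply is_derive_log_primitive; lra.
    + unfold log_primitive; rewrite ln_1, Rmult_1_r; field.
Qed.

(** * Integrals of Lipschitz paths in the complex plane *)

(** On the unit interval only. Lipschitz continuity is what averaging along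
    rays visibly preserves, and it makes every integral below exist. *)
Definition lipschitz (phi : R -> C) : Prop :=
  exists K, 0 <= K /\ forall s s', 0 <= s <= 1 -> 0 <= s' <= 1 ->
    Cmod (phi s - phi s') <= K * Rabs (s - s').

Definition cint (phi : R -> C) : C := RInt (V := C_R_CompleteNormedModule) phi 0 1.

(** Extends a path on [[0, 1]] to the whole line, where continuity gives
    integrability. *)
Definition clamp (t : R) : R := Rmax 0 (Rmin 1 t).

Lemma clamp_in t : 0 <= clamp t <= 1.
Proof.
  unfold clamp, Rmax, Rmin; repeat destruct Rle_dec; lra.
Qed.

Lemma clamp_id t : 0 <= t <= 1 -> clamp t = t.
Proof. unfold clamp, Rmax, Rmin; repeat destruct Rle_dec; lra. Qed.

Lemma clamp_contracting t u : Rabs (clamp t - clamp u) <= Rabs (t - u).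
Proof.
  unfold clamp, Rmax, Rmin; repeat destruct Rle_dec; unfold Rabs; repeat destruct Rcase_abs; lra.
Qed.

Lemma is_RInt_cint phi : lipschitz phi -> is_RInt (V := C_R_NormedModule) phi 0 1 (cint phi).
Proof.
  intros [K [K0 hK]].
  apply (RInt_correct (V := C_R_CompleteNormedModule)).
  apply (ex_RInt_ext (V := C_R_NormedModule) (fun t => phi (clamp t))).
  { intros t; rewrite Rmin_left, Rmax_right by lra; intros ht. rewrite clamp_id; trivial; lra. }
  apply (ex_RInt_continuous (V := C_R_CompleteNormedModule)); intros t _.
  apply filterlim_locally; intros eps.
  assert (hd : 0 < eps / (K + 1)).
  { apply Rdiv_lt_0_compat; [apply cond_pos | lra]. }
  exists (mkposreal _ hd); intros u hu.
  apply C_NormedModule_mixin_compat1.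
  change (Rabs (u - t) < eps / (K + 1)) in hu.
  change (Cmod (phi (clamp u) - phi (clamp t)) < eps).
  eapply Rle_lt_trans; [apply hK; apply clamp_in|].
  apply Rmult_lt_compat_l with (r := K + 1) in hu; [|lra].
  replace ((K + 1) * (eps / (K + 1))) with (pos eps) in hu by (field; lra).
  pose proof (clamp_contracting u t). pose proof (Rabs_pos (clamp u - clamp t)). nra.
Qed.

Lemma cint_unique phi l : is_RInt (V := C_R_NormedModule) phi 0 1 l -> cint phi = l.
Proof. apply (is_RInt_unique (V := C_R_CompleteNormedModule)). Qed.

Lemma Cmod_le_of_is_RInt phi l M : is_RInt (V := C_R_NormedModule) phi 0 1 l ->
  (forall t, 0 <= t <= 1 -> Cmod (phi t) <= M) -> Cmod l <= M.
Proof.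
  intros hphi hM. rewrite Cmod_norm.
  apply (norm_RInt_le (V := C_R_NormedModule) phi (fun _ => M) 0 1); trivial; [lra | |].
  - intros t ht. change (norm (V := C_R_NormedModule) (phi t)) with (norm (phi t : prod_NormedModule _ R_NormedModule R_NormedModule)).
    rewrite <- Cmod_norm. now apply hM.
  - generalize (is_RInt_const 0 1 M). unfold scal; simpl; unfold mult; simpl.
    now replace ((1 - 0) * M) with M by ring.
Qed.

Lemma is_RInt_Cmult_r (phi : R -> C) (l w : C) (a b : R) :
  is_RInt (V := C_R_NormedModule) phi a b l ->
  is_RInt (V := C_R_NormedModule) (fun t => phi t * w)%C a b (l * w)%C.
Proof.
  intros h.
  pose proof (is_RInt_fct_extend_fst (U := R_NormedModule) (V := R_NormedModule) _ _ _ _ h) as h1.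
  pose proof (is_RInt_fct_extend_snd (U := R_NormedModule) (V := R_NormedModule) _ _ _ _ h) as h2.
  apply (is_RInt_fct_extend_pair (U := R_NormedModule) (V := R_NormedModule) (fun t => phi t * w)%C); simpl.
  - apply (is_RInt_ext (fun t => minus (scal (fst w) (fst (phi t))) (scal (snd w) (snd (phi t))))).
    { intros t _; unfold minus, plus, opp, scal; simpl; unfold mult; simpl; ring. }
    replace (fst l * fst w - snd l * snd w) with (minus (scal (fst w) (fst l)) (scal (snd w) (snd l)))
      by (unfold minus, plus, opp, scal; simpl; unfold mult; simpl; ring).
    apply (is_RInt_minus (V := R_NormedModule)); now apply (is_RInt_scal (V := R_NormedModule)).
  - apply (is_RInt_ext (fun t => plus (scal (snd w) (fst (phi t))) (scal (fst w) (snd (phi t))))).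
    { intros t _; unfold plus, scal; simpl; unfold mult; simpl; ring. }
    replace (fst l * snd w + snd l * fst w) with (plus (scal (snd w) (fst l)) (scal (fst w) (snd l)))
      by (unfold plus, scal; simpl; unfold mult; simpl; ring).
    apply (is_RInt_plus (V := R_NormedModule)); now apply (is_RInt_scal (V := R_NormedModule)).
Qed.

(** The averaging operator on paths; [cavg] acts by it on the restriction of a
    function to a ray. *)
Definition path_avg (phi : R -> C) (s : R) : C := cint (fun t => phi (s * t)).

Lemma unit_mul s t : 0 <= s <= 1 -> 0 <= t <= 1 -> 0 <= s * t <= 1.
Proof. intros; nra. Qed.

Lemma lipschitz_scaled phi s : 0 <= s <= 1 -> lipschitz phi -> lipschitz (fun t => phi (s * t)).
Proof.
  intros hs [K [K0 hK]]; exists K; split; trivial; intros t t' ht ht'.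
  eapply Rle_trans; [apply hK; now apply unit_mul|].
  apply Rmult_le_compat_l; [trivial|].
  rewrite <- Rmult_minus_distr_l, Rabs_mult, (Rabs_pos_eq s) by lra.
  pose proof (Rabs_pos (t - t')); nra.
Qed.

Lemma is_RInt_path_avg phi s : 0 <= s <= 1 -> lipschitz phi ->
  is_RInt (V := C_R_NormedModule) (fun t => phi (s * t)) 0 1 (path_avg phi s).
Proof. intros hs hphi; now apply is_RInt_cint, lipschitz_scaled. Qed.

Lemma lipschitz_path_avg phi : lipschitz phi -> lipschitz (path_avg phi).
Proof.
  intros hphi; destruct (hphi) as [K [K0 hK]]; exists K; split; trivial; intros s s' hs hs'.
  apply (Cmod_le_of_is_RInt (fun t => phi (s * t)%R - phi (s' * t)%R)%C).
  - apply (is_RInt_minus (V := C_R_NormedModule)); now apply is_RInt_path_avg.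
  - intros t ht.
    eapply Rle_trans; [apply hK; now apply unit_mul|].
    apply Rmult_le_compat_l; [trivial|].
    rewrite <- Rmult_minus_distr_r, Rabs_mult, (Rabs_pos_eq t) by lra.
    pose proof (Rabs_pos (s - s')); nra.
Qed.

Lemma is_RInt_sum_n (phi : nat -> R -> C) (l : nat -> C) (a b : R) N :
  (forall n, is_RInt (V := C_R_NormedModule) (phi n) a b (l n)) ->
  is_RInt (V := C_R_NormedModule)
    (fun t => sum_n (G := C_AbelianMonoid) (fun n => phi n t) N) a b (sum_n (G := C_AbelianMonoid) l N).
Proof.
  intros h; induction N as [|N ih].
  - rewrite sum_O. apply (is_RInt_ext (V := C_R_NormedModule) (phi 0%nat)); [|apply h].
    intros t _; now rewrite sum_O.
  - rewrite sum_Sn.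
    apply (is_RInt_ext (V := C_R_NormedModule)
      (fun t => plus (sum_n (G := C_AbelianMonoid) (fun n => phi n t) N) (phi (S N) t))).
    { intros t _; now rewrite sum_Sn. }
    apply (is_RInt_plus (V := C_R_NormedModule)); auto.
Qed.

Lemma lipschitz_const w : lipschitz (fun _ => w).
Proof.
  exists 0; split; [lra|]; intros s s' _ _. replace (w - w)%C with (RtoC 0) by ring. rewrite Cmod_0; lra.
Qed.

Lemma lipschitz_RtoC : lipschitz RtoC.
Proof. exists 1; split; [lra|]; intros s s' _ _. rewrite <- RtoC_minus, Cmod_R; lra. Qed.

Lemma lipschitz_minus phi psi : lipschitz phi -> lipschitz psi -> lipschitz (fun s => phi s - psi s)%C.
Proof.
  intros [K [K0 hK]] [L [L0 hL]]; exists (K + L); split; [lra|]; intros s s' hs hs'.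
  replace (phi s - psi s - (phi s' - psi s'))%C with ((phi s - phi s') + - (psi s - psi s'))%C by ring.
  eapply Rle_trans; [apply Cmod_triangle|]. rewrite Cmod_opp, Rmult_plus_distr_r.
  apply Rplus_le_compat; auto.
Qed.

Lemma lipschitz_bounded phi : lipschitz phi -> exists M, 0 <= M /\ forall s, 0 <= s <= 1 -> Cmod (phi s) <= M.
Proof.
  intros [K [K0 hK]]; exists (Cmod (phi 0) + K).
  split; [apply Rplus_le_le_0_compat; [apply Cmod_ge_0 | trivial]|].
  intros s hs. replace (phi s) with (phi 0 + (phi s - phi 0))%C by ring.
  eapply Rle_trans; [apply Cmod_triangle|]. apply Rplus_le_compat_l.
  eapply Rle_trans; [apply hK; lra|].
  rewrite Rminus_0_r, (Rabs_pos_eq s) by lra. nra.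
Qed.

Lemma lipschitz_mult phi psi : lipschitz phi -> lipschitz psi -> lipschitz (fun s => phi s * psi s)%C.
Proof.
  intros hphi hpsi.
  destruct (lipschitz_bounded _ hphi) as [M [M0 hM]], (lipschitz_bounded _ hpsi) as [N [N0 hN]].
  destruct hphi as [K [K0 hK]], hpsi as [L [L0 hL]].
  exists (K * N + M * L); split; [nra|]; intros s s' hs hs'.
  replace (phi s * psi s - phi s' * psi s')%C
    with ((phi s - phi s') * psi s + phi s' * (psi s - psi s'))%C by ring.
  eapply Rle_trans; [apply Cmod_triangle|]. rewrite !Cmod_mult.
  replace ((K * N + M * L) * Rabs (s - s'))
    with ((K * Rabs (s - s')) * N + M * (L * Rabs (s - s'))) by ring.
  apply Rplus_le_compat; apply Rmult_le_compat; try apply Cmod_ge_0; auto.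
Qed.

Lemma lipschitz_inv phi e : 0 < e -> (forall s, 0 <= s <= 1 -> e <= Cmod (phi s)) ->
  lipschitz phi -> lipschitz (fun s => / phi s)%C.
Proof.
  intros e0 he [K [K0 hK]]; pose proof (Rinv_0_lt_compat e e0) as ie.
  exists (K * (/ e * / e)); split; [apply Rmult_le_pos; nra|]; intros s s' hs hs'.
  assert (hne : forall s, 0 <= s <= 1 -> phi s <> 0).
  { intros t ht; apply Cmod_gt_0; pose proof (he t ht); lra. }
  replace (/ phi s - / phi s')%C with ((phi s' - phi s) * (/ phi s * / phi s'))%C
    by (field; split; auto).
  rewrite !Cmod_mult, !Cmod_inv by auto.
  replace (K * (/ e * / e) * Rabs (s - s')) with (K * Rabs (s - s') * (/ e * / e)) by ring.
  apply Rmult_le_compat.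
  - apply Cmod_ge_0.
  - apply Rmult_le_pos; apply Rlt_le, Rinv_0_lt_compat; apply Rlt_le_trans with e; auto.
  - rewrite Rabs_minus_sym. auto.
  - apply Rmult_le_compat; try (apply Rlt_le, Rinv_0_lt_compat; apply Rlt_le_trans with e; now auto).
    all: apply Rinv_le_contravar; auto.
Qed.

Lemma lipschitz_pow phi n : lipschitz phi -> lipschitz (fun s => phi s ^ n)%C.
Proof.
  intros hphi; induction n as [|n ih]; [apply (lipschitz_const 1) | now apply (lipschitz_mult phi)].
Qed.

(** * Analytic continuation of the polylogarithm *)

Definition cavg (f : C -> C) (x : C) : C := cint (fun t => f (x * RtoC t)%C).

Definition taylor (c : nat -> R -> C) (h : C) (N : nat) (s : R) : C :=
  sum_n (G := C_AbelianMonoid) (fun n => c n s * h ^ n)%C N.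

(** The expansion of [f] around [a] is the case [s = 1]. The other values of
    [s] are there for the induction over [cavg], which averages [f] over rays:
    the bound on the remainders must not depend on [s]. *)
Definition expands (a : C) (d : R) (f : C -> C) (c : nat -> R -> C) : Prop :=
  (forall n, lipschitz (c n)) /\
  forall x, Cmod (x - a) < d ->
    lipschitz (fun s => f (x * RtoC s)%C) /\
    forall N s, 0 <= s <= 1 ->
      Cmod (f (x * RtoC s) - taylor c (x - a) N s)%C <=
        (Cmod (x - a) / d) ^ S N / (d - Cmod (x - a)).

Lemma cavg_radial f x s : cavg f (x * RtoC s)%C = path_avg (fun s => f (x * RtoC s)%C) s.
Proof.
  unfold cavg, path_avg, cint; apply (RInt_ext (V := C_R_CompleteNormedModule)); intros t _.
  now rewrite <- Cmult_assoc, <- RtoC_mult.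
Qed.

Lemma lipschitz_ext phi psi : (forall s, 0 <= s <= 1 -> phi s = psi s) -> lipschitz phi -> lipschitz psi.
Proof.
  intros e [K [K0 hK]]; exists K; split; trivial; intros s s' hs hs'. rewrite <- !e by trivial; auto.
Qed.

(** The remainder of the average is the average of the remainders, and a bound
    uniform in [s] passes to averages. *)
Lemma expands_cavg a d f c : expands a d f c -> expands a d (cavg f) (fun n => path_avg (c n)).
Proof.
  intros [hc hf]; split; [intros n; now apply lipschitz_path_avg|].
  intros x hx; destruct (hf x hx) as [hl hb]; split.
  - apply (lipschitz_ext (path_avg (fun s => f (x * RtoC s)%C))); [|now apply lipschitz_path_avg].
    intros s _; symmetry; apply cavg_radial.
  - intros N s hs; rewrite cavg_radial.
    apply (Cmod_le_of_is_RInt (fun t => f (x * RtoC (s * t)) - taylor c (x - a) N (s * t))%C).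
    + apply (is_RInt_minus (V := C_R_NormedModule)).
      * now apply (is_RInt_path_avg (fun s => f (x * RtoC s)%C)).
      * apply (is_RInt_sum_n (fun n t => c n (s * t)%R * (x - a) ^ n)%C
            (fun n => path_avg (c n) s * (x - a) ^ n)%C); intros n.
        now apply is_RInt_Cmult_r, is_RInt_path_avg.
    + intros t ht; now apply hb, unit_mul.
Qed.

Lemma expands_ext a d f c c' : (forall n s, 0 <= s <= 1 -> c n s = c' n s) -> expands a d f c -> expands a d f c'.
Proof.
  intros e [hc hf]; split.
  - intros n; apply (lipschitz_ext (c n)); auto.
  - intros x hx; destruct (hf x hx) as [hl hb]; split; trivial.
    intros N s hs. replace (taylor c' (x - a) N s) with (taylor c (x - a) N s); auto.
    apply sum_n_ext; intros n; now rewrite e.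
Qed.

Lemma pow_n_Cpow (h : C) n : pow_n (K := C_Ring) h n = (h ^ n)%C.
Proof. induction n as [|n ih]; [reflexivity | simpl; now rewrite ih]. Qed.

(** At [s = 1] the remainders tend to [0] as powers of [|x - a| / d < 1]. *)
Lemma expands_is_pseries a d f c x : expands a d f c -> Cmod (x - a)%C < d ->
  @is_pseries C_AbsRing C_NormedModule (fun n => c n 1) (x - a)%C (f x).
Proof.
  intros [_ hf] hx; destruct (hf x hx) as [_ hb].
  set (h := Cmod (x - a)%C) in *.
  assert (h0 : 0 <= h) by apply Cmod_ge_0.
  assert (hq : Rabs (h / d) < 1).
  { rewrite Rabs_pos_eq by (apply Rdiv_le_0_compat; lra). apply Rlt_div_l; lra. }
  apply filterlim_locally; intros eps.
  assert (he : 0 < eps * (d - h)) by (apply Rmult_lt_0_compat; [apply cond_pos | lra]).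
  destruct (pow_lt_1_zero _ hq _ he) as [N hN].
  exists N; intros n hn.
  apply C_NormedModule_mixin_compat1.
  rewrite <- Cmod_opp.
  replace (- minus _ (f x))%C with (f (x * RtoC 1) - taylor c (x - a) n 1)%C.
  - eapply Rle_lt_trans; [apply hb; lra|].
    apply Rlt_div_l; [lra|]. apply Rle_lt_trans with (1 := Rle_abs _), hN; lia.
  - rewrite Cmult_1_r; unfold taylor.
    rewrite (sum_n_ext (G := C_AbelianMonoid) _ (fun k => scal (V := C_ModuleSpace) (pow_n (K := C_Ring) (x - a)%C k) (c k 1))).
    + match goal with |- (_ - ?A)%C = (- minus ?B _)%C =>
        change (f x - A = - (A - f x))%C end. ring.
    + intros k; rewrite Cmult_comm, <- pow_n_Cpow; reflexivity.
Qed.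

Definition cgeom (u : C) : C := (/ (1 - u))%C.

(** Taylor coefficients of [1 / (1 - x s)] in powers of [x - a]. *)
Definition geom_coef (a : C) (n : nat) (s : R) : C :=
  (RtoC s ^ n / (1 - a * RtoC s) ^ S n)%C.

(** Used with [u = 1 - a s] and [v = (x - a) s], for which [u - v = 1 - x s]. *)
Lemma geom_remainder (u v : C) N : u <> 0 -> (u - v)%C <> 0 ->
  (/ (u - v) - sum_n (G := C_AbelianMonoid) (fun n => v ^ n / u ^ S n) N)%C = (v ^ S N / u ^ S N / (u - v))%C.
Proof.
  intros hu huv; induction N as [|N ih].
  - rewrite sum_O; simpl; field; auto.
  - rewrite sum_Sn.
    match goal with |- (_ - plus ?A ?B)%C = _ => change (/ (u - v) - (A + B) =
     v ^ S (S N) / u ^ S (S N) / (u - v))%C end.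
    match type of ih with (_ - ?A)%C = _ => replace A with (/ (u - v) - v ^ S N / u ^ S N / (u - v))%C by (rewrite <- ih; ring) end.
    pose proof (Cpow_nz u N hu). simpl; field; auto.
Qed.

Lemma expands_geom a d : 0 < d -> (forall s, 0 <= s <= 1 -> d <= Cmod (1 - a * RtoC s)) ->
  expands a d cgeom (geom_coef a).
Proof.
  intros d0 hd.
  assert (hlin : forall x, lipschitz (fun s => 1 - x * RtoC s)%C).
  { intros x; apply (lipschitz_minus (fun _ => 1) (fun s => x * RtoC s)%C); [apply lipschitz_const|].
    apply (lipschitz_mult (fun _ => x) RtoC); [apply lipschitz_const | apply lipschitz_RtoC]. }
  split.
  - intros n; unfold geom_coef.
    apply (lipschitz_mult (fun s => RtoC s ^ n)%C (fun s => / (1 - a * RtoC s) ^ S n)%C).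
    + apply lipschitz_pow, lipschitz_RtoC.
    + apply (lipschitz_inv (fun s => (1 - a * RtoC s) ^ S n)%C (d ^ S n)).
      * now apply pow_lt.
      * intros s hs; rewrite Cmod_pow; apply pow_incr; split; [lra | auto].
      * apply (lipschitz_pow (fun s => 1 - a * RtoC s)%C), hlin.
  - intros x hx; set (h := (x - a)%C) in *.
    assert (hb : forall s, 0 <= s <= 1 -> d - Cmod h <= Cmod (1 - x * RtoC s)).
    { intros s hs.
      pose proof (Cmod_triangle (1 - x * RtoC s) (h * RtoC s)) as ht.
      replace (1 - x * RtoC s + h * RtoC s)%C with (1 - a * RtoC s)%C in ht by (unfold h; ring).
      pose proof (hd s hs). rewrite Cmod_mult, Cmod_R, (Rabs_pos_eq s) in ht by lra.
      pose proof (Cmod_ge_0 h). nra. }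
    split.
    + apply (lipschitz_inv (fun s => 1 - x * RtoC s)%C (d - Cmod h)); auto; lra.
    + intros N s hs.
      assert (hu : (1 - a * RtoC s)%C <> 0).
      { apply Cmod_gt_0; pose proof (hd s hs); lra. }
      assert (hv : (1 - a * RtoC s - h * RtoC s)%C <> 0).
      { replace (1 - a * RtoC s - h * RtoC s)%C with (1 - x * RtoC s)%C by (unfold h; ring).
        apply Cmod_gt_0; pose proof (hb s hs); lra. }
      unfold cgeom, taylor.
      rewrite (sum_n_ext (G := C_AbelianMonoid) _ (fun n => (h * RtoC s) ^ n / (1 - a * RtoC s) ^ S n)%C).
      2:{ intros n; unfold geom_coef; rewrite Cpow_mult_l.
        match goal with |- ?A = ?B => change (@eq C A B) end. unfold Cdiv; ring. }
      replace (1 - x * RtoC s)%C with (1 - a * RtoC s - h * RtoC s)%C by (unfold h; ring).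
      rewrite geom_remainder by trivial.
      pose proof (Cpow_nz _ (S N) hu).
      rewrite !Cmod_div, !Cmod_pow, Cmod_mult, Cmod_R, (Rabs_pos_eq s) by (trivial; lra).
      replace (Cmod (1 - a * RtoC s - h * RtoC s)) with (Cmod (1 - x * RtoC s)) by (f_equal; unfold h; ring).
      pose proof (hb s hs) as hb'. pose proof (hd s hs) as hd'. pose proof (Cmod_ge_0 h).
      unfold Rdiv; rewrite (Rpow_mult_distr _ (/ d)), pow_inv.
      apply Rmult_le_compat.
      * apply Rmult_le_pos; [apply pow_le; apply Rmult_le_pos; lra | apply Rlt_le, Rinv_0_lt_compat, pow_lt; lra].
      * apply Rlt_le, Rinv_0_lt_compat; lra.
      * apply Rmult_le_compat.
        -- apply pow_le, Rmult_le_pos; lra.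
        -- apply Rlt_le, Rinv_0_lt_compat, pow_lt; lra.
        -- apply pow_incr; split; [apply Rmult_le_pos; lra | nra].
        -- apply Rinv_le_contravar; [apply pow_lt; lra | apply pow_incr; lra].
      * apply Rinv_le_contravar; lra.
Qed.

(** The points [a s] stay away from [1]. If [a] is not real, the distance from
    [1] to the line through [0] and [a] is [|Im a| / |a|]; if [a < 1] is real,
    the bound is attained at an end of the segment. *)
Lemma slit_plane_ray_bound (a : C) : slit_plane a ->
  exists d, 0 < d /\ forall s, 0 <= s <= 1 -> d <= Cmod (1 - a * RtoC s).
Proof.
  intros ha; destruct a as [p q]; unfold slit_plane in ha; simpl in ha.
  destruct (Req_dec q 0) as [-> | hq].
  - assert (p1 : p < 1) by (apply Rnot_le_lt; tauto).
    exists (Rmin 1 (1 - p)); split; [apply Rmin_pos; lra|].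
    intros s hs; eapply Rle_trans; [|apply re_le_Cmod].
    eapply Rle_trans; [|apply Rle_abs]. simpl.
    unfold Rmin; destruct Rle_dec; nra.
  - assert (hm : 0 < sqrt (p ^ 2 + q ^ 2)) by (apply sqrt_lt_R0; nra).
    exists (Rabs q / sqrt (p ^ 2 + q ^ 2)); split.
    + apply Rdiv_lt_0_compat; trivial. now apply Rabs_pos_lt.
    + intros s hs; apply Rle_div_l; trivial.
      rewrite <- sqrt_Rsqr_abs; unfold Cmod; simpl.
      rewrite <- sqrt_mult_alt
        by (apply Rplus_le_le_0_compat; rewrite Rmult_1_r; apply Rle_0_sqr).
      apply sqrt_le_1_alt; unfold Rsqr.
      (* With a = p + iq: |1 - as|^2 |a|^2 - q^2 is the square of |a|^2 s - p. *)
      match goal with |- _ <= ?r => replace r with (q * q + ((p * p + q * q) * s - p) ^ 2) by ring end.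
      pose proof (pow2_ge_0 ((p * p + q * q) * s - p)); lra.
Qed.

(** The analytic continuation of the polylogarithm, as an [m]-fold integral of
    [x / (1 - x t_1 ... t_m)] over the unit cube. *)
Definition polylog_int (m : nat) (x : C) : C := (x * Nat.iter m cavg cgeom x)%C.

Lemma expands_iter a d c m : expands a d cgeom c ->
  expands a d (Nat.iter m cavg cgeom) (Nat.iter m (fun c n => path_avg (c n)) c).
Proof.
  intros h; induction m as [|m ih]; [exact h | now apply expands_cavg].
Qed.

(** The factor [x = a + (x - a)] turns the coefficients [c_n] into [a c_n +
    c_{n-1}]. *)
Lemma analytic_polylog_int m : analytic_on slit_plane (polylog_int m).
Proof.
  intros a ha. destruct (slit_plane_ray_bound a ha) as [d [d0 hd]].
  pose proof (expands_iter a d _ m (expands_geom a d d0 hd)) as he.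
  set (c := Nat.iter m _ (geom_coef a)) in he.
  exists (PS_plus (PS_scal (V := C_NormedModule) a (fun n => c n 1)) (PS_incr_1 (fun n => c n 1))), d; split; trivial.
  intros x hx. pose proof (expands_is_pseries _ _ _ _ x he hx) as hp.
  replace (polylog_int m x) with
    (plus (scal (V := C_NormedModule) a (Nat.iter m cavg cgeom x)) (scal (V := C_NormedModule) (x - a)%C (Nat.iter m cavg cgeom x))).
  - apply (is_pseries_plus (V := C_NormedModule)).
    + apply (is_pseries_scal (V := C_NormedModule)); trivial. apply Cmult_comm.
    + now apply (is_pseries_incr_1 (V := C_NormedModule)).
  - unfold polylog_int, plus, scal; simpl; unfold mult; simpl. ring.
Qed.

Lemma path_avg_monomial (k : C) n s : path_avg (fun s => k * RtoC s ^ n)%C s = (k / RtoC (INR (S n)) * RtoC s ^ n)%C.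
Proof.
  apply cint_unique.
  assert (hi : is_RInt (fun t => t ^ n) 0 1 (/ INR (S n))).
  { pose proof (not_0_INR (S n) ltac:(lia)) as hn.
    replace (/ INR (S n)) with (minus (1 ^ S n / INR (S n)) (0 ^ S n / INR (S n))).
    - apply (is_RInt_derive (fun t => t ^ S n / INR (S n))).
      + intros t _. auto_derive; trivial.
        change (match n with 0%nat => 1 | S _ => INR n + 1 end) with (INR (S n)). simpl pred. field; trivial.
      + intros t _. apply @ex_derive_continuous; auto_derive; trivial.
    - unfold minus, plus, opp; simpl. rewrite pow1, Rmult_0_l.
      match goal with |- ?A = ?B => change (@eq R A B) end. unfold Rdiv; ring. }
  apply is_RInt_RtoC in hi.
  apply (is_RInt_Cmult_r _ _ (k * RtoC s ^ n)%C) in hi.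
  rewrite RtoC_inv in hi by (apply not_0_INR; lia).
  replace (k / RtoC (INR (S n)) * RtoC s ^ n)%C with (/ RtoC (INR (S n)) * (k * RtoC s ^ n))%C
    by (unfold Cdiv; ring).
  revert hi; apply (is_RInt_ext (V := C_R_NormedModule)); intros t _.
  rewrite RtoC_mult, Cpow_mult_l, RtoC_pow.
  match goal with |- ?A = ?B => change (@eq C A B) end. ring.
Qed.

(** At the origin the remainder estimates hold on the whole unit disc, and
    each averaging divides the coefficient of [s^n] by [n + 1]. *)
Lemma expands_at_0 m :
  expands 0 1 (Nat.iter m cavg cgeom) (fun n s => / RtoC (INR (S n)) ^ m * RtoC s ^ n)%C.
Proof.
  induction m as [|m ih].
  - apply (expands_ext _ _ _ (geom_coef 0)).
    + intros n s _; unfold geom_coef.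
      replace (1 - 0 * RtoC s)%C with (RtoC 1) by ring.
      rewrite Cpow_1_l. simpl; field.
    + apply expands_geom; [lra|]. intros s _.
      replace (1 - 0 * RtoC s)%C with (RtoC 1) by ring. rewrite Cmod_1; lra.
  - apply expands_cavg in ih; revert ih; apply expands_ext; intros n s _.
    rewrite path_avg_monomial.
    assert (hn : RtoC (INR (S n)) <> 0).
    { intros h; apply (not_0_INR (S n)); [lia | now injection h]. }
    pose proof (Cpow_nz _ m hn). rewrite Cpow_S. field; auto.
Qed.

Lemma is_series_polylog_int m (x : C) : Cmod x < 1 ->
  @is_series C_AbsRing C_NormedModule
    (fun n => (x ^ S n / RtoC (INR (S n)) ^ m)%C) (polylog_int m x).
Proof.
  intros hx.
  assert (hx0 : Cmod (x - 0)%C < 1) by (now replace (x - 0)%C with x by ring).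
  pose proof (expands_is_pseries _ _ _ _ x (expands_at_0 m) hx0) as hp.
  apply (is_series_scal_l (V := C_NormedModule) x) in hp.
  revert hp; apply (is_series_ext (V := C_NormedModule)); intros n.
  replace (x - 0)%C with x by ring.
  change (x * (pow_n (K := C_Ring) x n * (/ RtoC (INR (S n)) ^ m * RtoC 1 ^ n)) = x ^ S n / RtoC (INR (S n)) ^ m)%C.
  rewrite pow_n_Cpow, Cpow_1_l, Cpow_S. unfold Cdiv. ring.
Qed.

Lemma is_polylog_int m : is_polylog m (polylog_int m).
Proof.
  split; [apply analytic_polylog_int | intros x; apply is_series_polylog_int].
Qed.

(** * Uniqueness of the continuation along the real axis *)

Lemma is_series_proj (p : C -> R) (u : nat -> C) (l : C) :
  (forall x y, p (x + y)%C = p x + p y) ->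
  (forall e w, ball (M := C_UniformSpace) l e w -> ball (p l) e (p w)) ->
  @is_series C_AbsRing C_NormedModule u l -> is_series (fun n => p (u n)) (p l).
Proof.
  intros p_add p_ball h P [e he].
  assert (hl : locally (T := C_UniformSpace) l (fun w => P (p w))).
  { exists e; intros w hw; now apply he, p_ball. }
  specialize (h _ hl); revert h; unfold filtermap; apply filter_imp; intros n.
  enough (e' : forall n, p (sum_n (G := C_AbelianMonoid) u n) = sum_n (fun n => p (u n)) n)
    by (rewrite <- e'; trivial).
  clear n; intros n; induction n as [|n ih]; [now rewrite !sum_O|].
  rewrite !sum_Sn, <- ih; apply p_add.
Qed.

Lemma is_series_Re (u : nat -> C) (l : C) :
  @is_series C_AbsRing C_NormedModule u l -> is_series (fun n => Re (u n)) (Re l).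
Proof. apply is_series_proj; [reflexivity | now intros e w [h _]]. Qed.

Lemma is_series_Im (u : nat -> C) (l : C) :
  @is_series C_AbsRing C_NormedModule u l -> is_series (fun n => Im (u n)) (Im l).
Proof. apply is_series_proj; [reflexivity | now intros e w [_ h]]. Qed.

Lemma is_pseries_Re_Im (c : nat -> C) (h : R) (l : C) :
  @is_pseries C_AbsRing C_NormedModule c (RtoC h) l ->
  is_pseries (fun n => Re (c n)) h (Re l) /\ is_pseries (fun n => Im (c n)) h (Im l).
Proof.
  intros hp; split; [apply is_series_Re in hp | apply is_series_Im in hp];
  revert hp; apply is_series_ext; intros n;
  match goal with |- ?f (scal (pow_n ?x n) (c n)) = _ => change (f (pow_n (K := C_Ring) x n * c n)%C = pow_n h n * f (c n)) end;
  rewrite pow_n_Cpow, pow_n_pow, <- RtoC_pow; unfold Re, Im, Cmult; simpl; ring.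
Qed.

(** Convergence at one nonzero point makes the sum continuous at [0], and the
    value there is the constant coefficient. *)
Lemma pseries_constant_coef_eq_0 (c : nat -> R) (e : R) : 0 < e ->
  (forall h, 0 < h < e -> is_pseries c h 0) -> c 0%nat = 0.
Proof.
  intros e0 hc.
  assert (hr : Rbar_lt 0 (CV_radius c)).
  { apply Rbar_lt_le_trans with (e / 2); [simpl; lra|].
    apply Rbar_not_lt_le; intros hlt.
    apply (CV_disk_outside c (e / 2)).
    - now rewrite Rabs_pos_eq by lra.
    - assert (hs : ex_series (fun n => c n * (e / 2) ^ n)).
      { exists 0. generalize (hc (e / 2) ltac:(lra)); apply is_series_ext; intros k.
        rewrite pow_n_pow; apply Rmult_comm. }
      exact (ex_series_lim_0 _ hs). }
  rewrite <- (PSeries_0 c).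
  assert (hl : filterlim (PSeries c) (at_right 0) (locally (PSeries c 0))).
  { eapply filterlim_filter_le_1; [apply filter_le_within|].
    apply continuity_pt_filterlim, PSeries_continuity. now rewrite Rabs_R0. }
  apply (filterlim_locally_unique (F := at_right 0) (PSeries c)); trivial.
  apply (filterlim_ext_loc (fun _ => 0)); [|apply filterlim_const].
  exists (mkposreal e e0); intros h hh h0. symmetry; apply is_pseries_unique, hc.
  change (Rabs (h - 0) < e) in hh. rewrite Rminus_0_r, Rabs_pos_eq in hh; lra.
Qed.

(** Dividing by [h] removes the constant coefficient once it is known to
    vanish. *)
Lemma pseries_coef_eq_0 (n : nat) : forall (c : nat -> R) (e : R), 0 < e ->
  (forall h, 0 < h < e -> is_pseries c h 0) -> c n = 0.
Proof.
  induction n as [|n ih]; intros c e e0 hc; [now apply (pseries_constant_coef_eq_0 c e)|].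
  apply (ih (PS_decr_1 c) e e0); intros h hh.
  pose proof (is_pseries_decr_1 c h (/ h) 0) as hd.
  rewrite (pseries_constant_coef_eq_0 c e e0 hc) in hd.
  match type of hd with _ -> _ -> is_pseries _ _ ?l => replace l with 0 in hd end.
  - apply hd; [unfold mult, one; simpl; field; lra | auto].
  - unfold scal, plus, opp; simpl; unfold mult; simpl; ring.
Qed.

Lemma is_pseries_coef_0 (c : nat -> R) (h l : R) : (forall n, c n = 0) -> is_pseries c h l -> l = 0.
Proof.
  intros hc hl. apply is_pseries_unique in hl. rewrite <- hl.
  unfold PSeries. rewrite (Series_ext _ (fun n => 0 * 0)).
  - rewrite Series_scal_l; ring.
  - intros n; rewrite hc; ring.
Qed.

(** Identity principle at the boundary point of an interval of zeros: the
    zeros are known on the right of the centre only. *)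
Lemma is_pseries_eq_0 (c : nat -> C) (f : R -> C) (r e : R) : 0 < e <= r ->
  (forall h, Rabs h < r -> @is_pseries C_AbsRing C_NormedModule c (RtoC h) (f h)) ->
  (forall h, 0 < h < e -> f h = 0) -> forall h, Rabs h < r -> f h = 0.
Proof.
  intros er hf h0.
  assert (hz : forall n, Re (c n) = 0 /\ Im (c n) = 0).
  { intros n; split; [apply (pseries_coef_eq_0 n (fun n => Re (c n)) e) | apply (pseries_coef_eq_0 n (fun n => Im (c n)) e)];
    try lra; intros h hh; assert (hr : Rabs h < r) by (rewrite Rabs_pos_eq; lra);
    destruct (is_pseries_Re_Im c h _ (hf h hr)) as [h1 h2]; rewrite h0 in h1, h2 by trivial; trivial. }
  intros h hr; destruct (is_pseries_Re_Im c h _ (hf h hr)) as [h1 h2].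
  rewrite (surjective_pairing (f h)); apply f_equal2.
  - apply (is_pseries_coef_0 (fun n => Re (c n)) h); [intros n; apply hz | trivial].
  - apply (is_pseries_coef_0 (fun n => Im (c n)) h); [intros n; apply hz | trivial].
Qed.

Lemma slit_plane_RtoC x : x < 1 -> slit_plane (RtoC x).
Proof. intros hx [_ h]; simpl in h; lra. Qed.

(** Let [m] be the supremum of the [t] for which [f] vanishes on [[-t, 0]]. If
    [m] were finite, the identity principle at [-m] would extend the zeros
    beyond [-m]. *)
Lemma analytic_eq_0 (f : C -> C) : analytic_on slit_plane f ->
  (forall x, Cmod x < 1 -> f x = 0) -> forall x, x < 1 -> f (RtoC x) = 0.
Proof.
  intros hf h0 x x1.
  destruct (classic (f (RtoC x) = 0)) as [|hx]; trivial; exfalso.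
  set (E := fun t => 0 <= t /\ forall u, 0 <= u <= t -> f (RtoC (- u)) = 0).
  assert (E0 : E (1 / 2)).
  { split; [lra|]. intros u hu; apply h0. rewrite Cmod_R, Rabs_left1; lra. }
  assert (xn : x <= - 1).
  { apply Rnot_lt_le; intros h. apply hx, h0; rewrite Cmod_R. apply Rabs_def1; lra. }
  destruct (completeness E) as [m [m_ub m_lub]].
  - exists (- x); intros t [t0 ht]. apply Rnot_lt_le; intros h.
    apply hx. replace x with (- - x) by ring. apply ht; lra.
  - now exists (1 / 2).
  - assert (m1 : 1 / 2 <= m) by (now apply m_ub).
    destruct (hf (RtoC (- m)) (slit_plane_RtoC (- m) ltac:(lra))) as [c [r [r0 hr]]].
    assert (hl : forall h, 0 < h <= m -> f (RtoC (- m + h)) = 0).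
    { intros h hh; destruct (classic (exists t, E t /\ m - h <= t)) as [[t [[t0 ht] hmt]] | hn].
      - replace (- m + h) with (- (m - h)) by ring. apply ht; lra.
      - assert (m <= m - h); [|lra].
        apply m_lub; intros t ht. apply Rnot_lt_le; intros hlt. apply hn; exists t; split; trivial; lra. }
    assert (hz : forall h, Rabs h < r -> f (RtoC (- m + h)) = 0).
    { apply (is_pseries_eq_0 c (fun h => f (RtoC (- m + h))) r (Rmin r m)); trivial.
      - split; [apply Rmin_pos; lra | apply Rmin_l].
      - intros h hh. specialize (hr (RtoC (- m + h))).
        replace (RtoC (- m + h) - RtoC (- m))%C with (RtoC h) in hr.
        + apply hr. now rewrite Cmod_R.
        + rewrite <- RtoC_minus; f_equal; ring.
      - intros h hh; pose proof (Rmin_r r m); apply hl; lra. }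
    assert (hE : E (m + r / 2)).
    { split; [lra|]. intros u hu. destruct (Rlt_or_le u m) as [hlt | hge].
      - replace (- u) with (- m + (m - u)) by ring.
        apply hl; lra.
      - replace (- u) with (- m + (m - u)) by ring. apply hz, Rabs_def1; lra. }
    pose proof (m_ub _ hE); lra.
Qed.

(** * Values of the polylogarithm on the real axis *)

Lemma cavg_RtoC (f : C -> C) (g : R -> R) : continuous_below_1 g ->
  (forall x, x < 1 -> f (RtoC x) = RtoC (g x)) ->
  forall x, x < 1 -> cavg f (RtoC x) = RtoC (avg g x).
Proof.
  intros cg hfg x x1; apply cint_unique.
  apply (is_RInt_ext (V := C_R_NormedModule) (fun t => RtoC (g (x * t)))).
  - rewrite Rmin_left, Rmax_right by lra. intros t ht.
    rewrite <- RtoC_mult. symmetry; apply hfg, scaled_lt_1; lra.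
  - apply is_RInt_RtoC, (RInt_correct (V := R_CompleteNormedModule)). now apply ex_RInt_scaled.
Qed.

Lemma polylog_int_RtoC m x : x < 1 -> polylog_int m (RtoC x) = RtoC (Li m x).
Proof.
  unfold polylog_int, Li, iter_int; revert x.
  enough (h : forall x, x < 1 -> Nat.iter m cavg cgeom (RtoC x) = RtoC (Nat.iter m avg geom x)).
  { intros x x1; now rewrite h, <- RtoC_mult. }
  induction m as [|m ih]; intros x x1.
  - simpl; unfold cgeom, geom. rewrite <- RtoC_minus, RtoC_inv; [reflexivity | lra].
  - simpl. apply cavg_RtoC; trivial. apply iter_avg_continuous, geom_continuous.
Qed.

(** The choice made by [epsilon] is some analytic continuation of the series,
    and it agrees on [(-oo, 1)] with the one constructed above. *)
Lemma polylog_RtoC m x : x < 1 -> polylog m (RtoC x) = RtoC (Li m x).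
Proof.
  intros x1; rewrite <- polylog_int_RtoC by trivial.
  assert (hp : is_polylog m (polylog m)).
  { unfold polylog; apply epsilon_spec. exists (polylog_int m); apply is_polylog_int. }
  destruct hp as [ha hs], (is_polylog_int m) as [ha' hs'].
  enough (e : (polylog m (RtoC x) - polylog_int m (RtoC x) = 0)%C).
  { replace (polylog m (RtoC x)) with (polylog m (RtoC x) - polylog_int m (RtoC x) + polylog_int m (RtoC x))%C by ring.
    rewrite e; ring. }
  apply (analytic_eq_0 (fun x => polylog m x - polylog_int m x)%C); trivial.
  - intros a h. destruct (ha a h) as [c [r [r0 hc]]], (ha' a h) as [c' [r' [r0' hc']]].
    exists (PS_minus (V := C_NormedModule) c c'), (Rmin r r'); split; [now apply Rmin_pos|].
    intros y hy. apply (is_pseries_minus (V := C_NormedModule)).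
    + apply hc. eapply Rlt_le_trans; [exact hy | apply Rmin_l].
    + apply hc'. eapply Rlt_le_trans; [exact hy | apply Rmin_r].
  - intros y hy. rewrite (filterlim_locally_unique (V := C_NormedModule) _ _ _ (hs y hy) (hs' y hy)). ring.
Qed.

Lemma is_series_Li m x : Rabs x < 1 -> is_series (fun n => x ^ S n / INR (S n) ^ m) (Li m x).
Proof.
  intros hx. assert (hx' : Cmod (RtoC x) < 1) by (now rewrite Cmod_R).
  pose proof (is_series_Re _ _ (is_series_polylog_int m _ hx')) as h.
  rewrite polylog_int_RtoC in h by (apply Rabs_def2 in hx; lra).
  revert h; apply is_series_ext; intros n.
  rewrite <- !RtoC_pow, <- RtoC_div; [reflexivity|].
  apply pow_nonzero, not_0_INR; lia.
Qed.

(** Comparison series for [zeta]. *)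
Lemma is_series_telescoping : is_series (fun n => / (INR (S n) * INR (S (S n)))) 1.
Proof.
  change (is_lim_seq (sum_n (fun n => / (INR (S n) * INR (S (S n))))) 1).
  apply (is_lim_seq_ext (fun n => 1 - / INR (S (S n)))).
  - intros n; induction n as [|n ih].
    + rewrite sum_O; simpl; field.
    + rewrite sum_Sn, <- ih, !S_INR. unfold plus; simpl. pose proof (pos_INR n).
      match goal with |- ?A = ?B => change (@eq R A B) end. field; lra.
  - replace (Finite 1) with (Finite (1 - 0)) by (f_equal; ring).
    apply is_lim_seq_minus'; [apply is_lim_seq_const|].
    apply (is_lim_seq_inv _ p_infty); [|easy].
    apply (is_lim_seq_incr_1 (fun n => INR (S n))), (is_lim_seq_incr_1 INR), is_lim_seq_INR.
Qed.

Lemma ex_series_zeta m : (2 <= m)%nat -> ex_series (fun n => / INR (S n) ^ m).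
Proof.
  intros hm. apply (ex_series_le (V := R_CompleteNormedModule) _ (fun n => 2 * / (INR (S n) * INR (S (S n))))).
  - intros n. change (Rabs (/ INR (S n) ^ m) <= 2 * / (INR (S n) * INR (S (S n)))).
    assert (h : 1 <= INR (S n)) by (rewrite S_INR; pose proof (pos_INR n); lra).
    rewrite Rabs_pos_eq by (apply Rlt_le, Rinv_0_lt_compat, pow_lt; lra).
    apply Rle_trans with (/ INR (S n) ^ 2).
    + apply Rinv_le_contravar; [apply pow_lt; lra | now apply Rle_pow].
    + rewrite (S_INR (S n)).
      replace (2 * / (INR (S n) * (INR (S n) + 1))) with (/ (INR (S n) * (INR (S n) + 1) / 2))
        by (field; lra).
      apply Rinv_le_contravar; nra.
  - exists (2 * 1). apply (is_series_scal_l (V := R_NormedModule) 2), is_series_telescoping.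
Qed.

Lemma sum_n_le_of_is_series (a : nat -> R) (l : R) N : (forall n, 0 <= a n) -> is_series a l -> sum_n a N <= l.
Proof.
  intros a0 ha; apply (is_lim_seq_incr_compare (sum_n a)); [exact ha|].
  intros n; rewrite sum_Sn; unfold plus; simpl. pose proof (a0 (S n)); lra.
Qed.

Lemma tends_sum_n (u : nat -> R -> R) (l : nat -> R) N : (forall n, tends (u n) (l n)) ->
  tends (fun z => sum_n (fun n => u n z) N) (sum_n l N).
Proof.
  intros h; induction N as [|N ih].
  - rewrite sum_O. apply (filterlim_ext (u 0%nat)); [|apply h]. intros z; now rewrite sum_O.
  - rewrite sum_Sn. apply (filterlim_ext (fun z => sum_n (fun n => u n z) N + u (S N) z)).
    + intros z; now rewrite sum_Sn.
    + now apply tends_plus.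
Qed.

(** Abel's theorem for positive coefficients: partial sums, continuous at [1],
    bound [Li m] from below and [zeta m] bounds it from above. *)
Lemma tends_Li_at_1 m (phi : R -> R) : (2 <= m)%nat ->
  (forall z, 0 < z -> 0 < phi z < 1) -> tends phi 1 -> tends (fun z => Li m (phi z)) (zeta m).
Proof.
  intros hm hphi h1.
  pose proof (Series_correct _ (ex_series_zeta m hm)) as hz. fold (zeta m) in hz.
  assert (hpos : forall n, 0 < / INR (S n) ^ m) by (intros n; apply Rinv_0_lt_compat, pow_lt, lt_0_INR; lia).
  apply filterlim_locally; intros eps.
  assert (hN : exists N, zeta m - eps / 2 < sum_n (fun n => / INR (S n) ^ m) N).
  { pose proof (proj1 (filterlim_locally _ _) hz (pos_div_2 eps)) as [N hN].
    exists N; specialize (hN N (Nat.le_refl N)).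
    change (Rabs (sum_n (fun n => / INR (S n) ^ m) N - zeta m) < eps / 2) in hN.
    apply Rabs_def2 in hN; lra. }
  destruct hN as [N hN].
  assert (hl : tends (fun z => sum_n (fun n => phi z ^ S n / INR (S n) ^ m) N) (sum_n (fun n => / INR (S n) ^ m) N)).
  { apply tends_sum_n; intros n. eapply tends_eq; [apply tends_div, tends_pow, h1|].
    rewrite pow1; unfold Rdiv; ring. }
  pose proof (proj1 (filterlim_locally _ _) hl (pos_div_2 eps)) as hd.
  assert (hr : at_right 0 (fun z => 0 < z)) by (exists (mkposreal 1 Rlt_0_1); trivial).
  generalize (filter_and _ _ hd hr); apply filter_imp; clear hd hr; intros z [hd z0].
  change (Rabs (sum_n (fun n => phi z ^ S n / INR (S n) ^ m) N - sum_n (fun n => / INR (S n) ^ m) N) < eps / 2) in hd.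
  change (Rabs (Li m (phi z) - zeta m) < eps).
  apply Rabs_def2 in hd. destruct (hphi z z0) as [p0 p1].
  assert (hs : is_series (fun n => phi z ^ S n / INR (S n) ^ m) (Li m (phi z))) by (apply is_series_Li, Rabs_def1; lra).
  assert (hle : sum_n (fun n => phi z ^ S n / INR (S n) ^ m) N <= Li m (phi z)).
  { apply sum_n_le_of_is_series; trivial. intros n; apply Rmult_le_pos; [apply pow_le; lra | now apply Rlt_le]. }
  assert (hup : Li m (phi z) <= zeta m).
  { rewrite <- (is_series_unique _ _ hs). unfold zeta; apply Series_le; [|now apply ex_series_zeta].
    intros n; split; [apply Rmult_le_pos; [apply pow_le; lra | now apply Rlt_le]|].
    rewrite <- (Rmult_1_l (/ _)); apply Rmult_le_compat_r; [now apply Rlt_le|].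
    rewrite <- (pow1 (S n)); apply pow_incr; lra. }
  pose proof (cond_pos eps). apply Rabs_def1; lra.
Qed.

(** * The three arguments as functions of z *)

Definition coth (z : R) : R := (exp (2 * z) + 1) / (exp (2 * z) - 1).

(** The arguments [x], [y], [w] of the formula. They satisfy [y = x / (x - 1)]
    and [w = 1 / (1 - x) = 1 - y], which is why the functional equations
    relate them. *)
Definition X (z : R) := 1 - exp (2 * z).
Definition Y (z : R) := 1 - exp (- 2 * z).
Definition W (z : R) := exp (- 2 * z).

Lemma exp_m2 (z : R) : exp (- 2 * z) = / exp (2 * z).
Proof. rewrite <- exp_Ropp; f_equal; ring. Qed.

Lemma exp_gt_1 (z : R) : 0 < z -> 1 < exp (2 * z).
Proof. intros hz; rewrite <- exp_0; apply exp_increasing; lra. Qed.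

Lemma X_lt_1 z : X z < 1.
Proof. unfold X; pose proof (exp_pos (2 * z)); lra. Qed.

Lemma Y_lt_1 z : Y z < 1.
Proof. unfold Y; pose proof (exp_pos (- 2 * z)); lra. Qed.

Lemma W_lt_1 z : 0 < z -> W z < 1.
Proof. intros hz; unfold W; rewrite <- exp_0; apply exp_increasing; lra. Qed.

(** [dx/x = (coth z + 1) dz]. *)
Lemma is_derive_X f j z : continuous_below_1 f -> 0 < z ->
  is_derive (fun v => iter_int f (S j) (X v)) z (iter_int f j (X z) * (coth z + 1)).
Proof.
  intros cf hz; apply (is_derive_iter_int_comp f X j z (- 2 * exp (2 * z))); trivial.
  - apply X_lt_1.
  - unfold X; auto_derive; trivial; ring.
  - unfold X, coth. pose proof (exp_gt_1 z hz). field; lra.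
Qed.

(** [dy/y = (coth z - 1) dz]. *)
Lemma is_derive_Y f j z : continuous_below_1 f -> 0 < z ->
  is_derive (fun v => iter_int f (S j) (Y v)) z (iter_int f j (Y z) * (coth z - 1)).
Proof.
  intros cf hz; apply (is_derive_iter_int_comp f Y j z (2 * exp (- 2 * z))); trivial.
  - apply Y_lt_1.
  - unfold Y; auto_derive; trivial; ring.
  - unfold Y, coth. rewrite exp_m2. pose proof (exp_gt_1 z hz). field; lra.
Qed.

Lemma is_derive_W f j z : continuous_below_1 f -> 0 < z ->
  is_derive (fun v => iter_int f (S j) (W v)) z (iter_int f j (W z) * - 2).
Proof.
  intros cf hz; apply (is_derive_iter_int_comp f W j z (- 2 * exp (- 2 * z))); trivial.
  - now apply W_lt_1.
  - unfold W; auto_derive; trivial; ring.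
Qed.

Lemma is_derive_ln_2sinh z : 0 < z -> is_derive (fun v => ln (2 * sinh v)) z (coth z).
Proof.
  intros hz; unfold coth, sinh.
  pose proof (exp_gt_1 z hz) as h.
  replace (2 * z) with (z + z) in h |- * by ring. rewrite exp_plus in h |- *.
  pose proof (exp_pos z).
  auto_derive; rewrite exp_Ropp.
  - assert (/ exp z < exp z); [|lra].
    apply Rmult_lt_reg_l with (exp z); trivial. rewrite Rinv_r; lra.
  - field. lra.
Qed.

(** The form in which all functional equations are proved: a constant function
    equals its limit at the origin. *)
Lemma eq_0_of_derive_0 (f : R -> R) :
  (forall z, 0 < z -> is_derive f z 0) ->
  filterlim f (at_right 0) (locally 0) ->
  forall z, 0 < z -> f z = 0.
Proof.
  intros hd hl z hz.
  apply (filterlim_locally_unique (F := at_right 0) (fun _ => f z)).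
  - apply filterlim_const.
  - apply (filterlim_ext_loc f); trivial.
    exists (mkposreal z hz); intros u hu u0.
    unfold ball in hu; simpl in hu; unfold AbsRing_ball, abs, minus, plus, opp in hu; simpl in hu.
    rewrite Ropp_0, Rplus_0_r, Rabs_pos_eq in hu by lra.
    apply (eq_is_derive f); trivial. intros; apply hd; lra.
Qed.

(** For [0 < z < 1] the bounds [z <= 2 sinh z <= e^z] give [ln z <= ln (2 sinh
    z) <= z]. *)
Lemma tends_mul_ln_2sinh : tends (fun z => z * ln (2 * sinh z)) 0.
Proof.
  apply (tends_squeeze _ (fun z => Rabs (z * ln z) + z ^ 2)).
  - intros z hz.
    pose proof (exp_ineq1_le z) as h.
    assert (h' : exp (- z) < 1) by (rewrite <- exp_0; apply exp_increasing; lra).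
    pose proof (exp_pos (- z)).
    replace (2 * sinh z) with (exp z - exp (- z)) by (unfold sinh; field).
    assert (u : ln (exp z - exp (- z)) <= z).
    { rewrite <- (ln_exp z) at 3. apply ln_le; lra. }
    assert (l : ln z <= ln (exp z - exp (- z))) by (apply ln_le; lra).
    rewrite !Rabs_mult, (Rabs_pos_eq z) by lra.
    replace (z ^ 2) with (z * z) by ring. rewrite <- Rmult_plus_distr_l.
    apply Rmult_le_compat_l; [lra|].
    revert u l; generalize (ln (exp z - exp (- z))), (ln z); intros.
    unfold Rabs; repeat destruct Rcase_abs; lra.
  - eapply tends_eq.
    + apply tends_plus; [|apply tends_pow, tends_id].
      apply (tends_continuous Rabs); [apply tends_mul_ln | apply continuous_Rabs].
    + rewrite Rabs_R0; ring.
Qed.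

Lemma tends_comp_vanishing f j (phi : R -> R) : continuous_below_1 f -> phi 0 = 0 -> continuous phi 0 ->
  tends (fun z => iter_int f j (phi z)) 0.
Proof.
  intros cf p0 cphi; rewrite <- (iter_int_0 f j).
  apply (tends_continuous (iter_int f j) phi).
  - replace 0 with (phi 0). now apply (tends_continuous phi (fun z => z)); [apply tends_id|].
  - apply iter_int_continuous; trivial; lra.
Qed.

Lemma tends_X f j : continuous_below_1 f -> tends (fun z => iter_int f j (X z)) 0.
Proof.
  intros cf; apply tends_comp_vanishing; trivial; unfold X.
  - rewrite Rmult_0_r, exp_0; ring.
  - apply @ex_derive_continuous; auto_derive; trivial.
Qed.

Lemma tends_Y f j : continuous_below_1 f -> tends (fun z => iter_int f j (Y z)) 0.
Proof.
  intros cf; apply tends_comp_vanishing; trivial; unfold Y.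
  - rewrite Rmult_0_r, exp_0; ring.
  - apply @ex_derive_continuous; auto_derive; trivial.
Qed.

Lemma tends_Li_W m : (2 <= m)%nat -> tends (fun z => Li m (W z)) (zeta m).
Proof.
  intros hm; apply tends_Li_at_1; trivial.
  - intros z hz; split; [apply exp_pos | now apply W_lt_1].
  - replace 1 with (W 0) by (unfold W; rewrite Rmult_0_r; apply exp_0).
    apply (tends_continuous W (fun z => z)); [apply tends_id|].
    apply @ex_derive_continuous; unfold W; auto_derive; trivial.
Qed.

(** Finds the derivative in [z] of a polynomial in [z], [ln (2 sinh z)] and
    iterated integrals at [X z], [Y z], [W z]. *)
Ltac differentiate :=
  lazymatch goal with
  | |- is_derive (fun _ => ?c) _ _ => apply (der_const c)
  | |- is_derive (fun v => v) _ _ => apply der_id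
  | |- is_derive (fun v => Li (S ?j) (X v)) _ _ =>
      apply (is_derive_X geom j); [apply geom_continuous | assumption]
  | |- is_derive (fun v => Li (S ?j) (Y v)) _ _ =>
      apply (is_derive_Y geom j); [apply geom_continuous | assumption]
  | |- is_derive (fun v => Li (S ?j) (W v)) _ _ =>
      apply (is_derive_W geom j); [apply geom_continuous | assumption]
  | |- is_derive (fun v => nielsen2 (S ?j) (X v)) _ _ =>
      apply (is_derive_X log_sq_kernel j); [apply log_sq_kernel_continuous | assumption]
  | |- is_derive (fun v => nielsen2 (S ?j) (Y v)) _ _ =>
      apply (is_derive_Y log_sq_kernel j); [apply log_sq_kernel_continuous | assumption]
  | |- is_derive (fun v => ln (2 * sinh v)) _ _ => apply is_derive_ln_2sinh; assumption
  | |- is_derive (fun v => @?f v + @?g v) _ _ => apply (der_plus f g); differentiate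
  | |- is_derive (fun v => @?f v - @?g v) _ _ => apply (der_minus f g); differentiate
  | |- is_derive (fun v => @?f v / ?c) _ _ => apply (der_div f c); differentiate
  | |- is_derive (fun v => @?f v * @?g v) _ _ => apply (der_mult f g); differentiate
  | |- is_derive (fun v => @?f v ^ ?n) _ _ => apply (der_pow f n); differentiate
  end.

Ltac pass_to_limit :=
  lazymatch goal with
  | |- tends (fun _ => ?c) _ => apply (tends_const c)
  | |- tends (fun v => v) _ => apply tends_id
  | |- tends (fun v => Li ?j (X v)) _ => apply (tends_X geom j geom_continuous)
  | |- tends (fun v => Li ?j (Y v)) _ => apply (tends_Y geom j geom_continuous)
  | |- tends (fun v => Li ?j (W v)) _ => apply (tends_Li_W j); repeat constructor
  | |- tends (fun v => nielsen2 ?j (X v)) _ => apply (tends_X log_sq_kernel j log_sq_kernel_continuous)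
  | |- tends (fun v => nielsen2 ?j (Y v)) _ => apply (tends_Y log_sq_kernel j log_sq_kernel_continuous)
  | |- tends (fun v => v * ln (2 * sinh v)) _ => apply tends_mul_ln_2sinh
  | |- tends (fun v => @?f v + @?g v) _ => apply (tends_plus f g); pass_to_limit
  | |- tends (fun v => @?f v - @?g v) _ => apply (tends_minus f g); pass_to_limit
  | |- tends (fun v => @?f v / ?c) _ => apply (tends_div f c); pass_to_limit
  | |- tends (fun v => @?f v * @?g v) _ => apply (tends_mult f g); pass_to_limit
  | |- tends (fun v => @?f v ^ ?n) _ => apply (tends_pow f); pass_to_limit
  end.

(** Reduces an equation on [z > 0] to the vanishing of the derivative; the
    limit at the origin is computed and checked to be [0]. *)
Ltac vanish :=
  match goal with |- forall z, 0 < z -> @?f z = 0 =>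
    apply (eq_0_of_derive_0 f);
    [ let hz := fresh "hz" in intros z hz; eapply der_eq; [differentiate|];
      change (iter_int geom) with Li; change (iter_int log_sq_kernel) with nielsen2;
      simpl INR; simpl pred
    | change (tends f 0); eapply tends_eq; [pass_to_limit | field ] ]
  end.

(** * The functional equations *)

Lemma Li_1_X z : Li 1 (X z) = - (2 * z).
Proof.
  rewrite Li_1 by apply X_lt_1; unfold X.
  replace (1 - (1 - exp (2 * z))) with (exp (2 * z)) by ring. now rewrite ln_exp.
Qed.

Lemma Li_1_Y z : Li 1 (Y z) = 2 * z.
Proof.
  rewrite Li_1 by apply Y_lt_1; unfold Y.
  replace (1 - (1 - exp (- 2 * z))) with (exp (- 2 * z)) by ring. rewrite ln_exp; ring.
Qed.

Lemma Li_1_W z : 0 < z -> Li 1 (W z) = z - ln (2 * sinh z).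
Proof.
  intros hz; rewrite Li_1 by now apply W_lt_1; unfold W.
  enough (e : 2 * sinh z = exp z * (1 - W z)).
  { pose proof (W_lt_1 z hz); unfold W in *.
    rewrite e, ln_mult, ln_exp; [ring | apply exp_pos | lra]. }
  unfold W, sinh; rewrite Rmult_minus_distr_l, <- exp_plus.
  replace (z + - 2 * z) with (- z) by ring. field.
Qed.

Lemma nielsen2_0_X z : nielsen2 0 (X z) = 2 * z ^ 2.
Proof.
  rewrite nielsen2_0 by apply X_lt_1; unfold X.
  replace (1 - (1 - exp (2 * z))) with (exp (2 * z)) by ring. rewrite ln_exp; field.
Qed.

Lemma nielsen2_0_Y z : nielsen2 0 (Y z) = 2 * z ^ 2.
Proof.
  rewrite nielsen2_0 by apply Y_lt_1; unfold Y.
  replace (1 - (1 - exp (- 2 * z))) with (exp (- 2 * z)) by ring. rewrite ln_exp; field.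
Qed.

(** Landen's equation for the dilogarithm, with [log (1 - x) = 2 z]. *)
Lemma Li2_X_Y : forall z, 0 < z -> Li 2 (X z) + Li 2 (Y z) + 2 * z ^ 2 = 0.
Proof.
  vanish. rewrite Li_1_X, Li_1_Y. ring.
Qed.

(** The function [log (1 - u) ^ 2 / 2] takes the same value [2 z ^ 2] at [x]
    and [y], and [dx/x - dy/y = 2 dz]. *)
Lemma nielsen2_1_X_sub_Y : forall z, 0 < z -> nielsen2 1 (X z) - nielsen2 1 (Y z) - 4 * z ^ 3 / 3 = 0.
Proof.
  vanish. rewrite nielsen2_0_X, nielsen2_0_Y. field.
Qed.

(** The coefficient of [coth z] in the derivative vanishes by Landen's
    equation, the rest cancels. *)
Lemma nielsen2_1_X_add_Y : forall z, 0 < z ->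
  nielsen2 1 (X z) + nielsen2 1 (Y z) - 2 * Li 3 (X z) - 2 * Li 3 (Y z)
  + 2 * z * (Li 2 (X z) - Li 2 (Y z)) = 0.
Proof.
  vanish. rewrite nielsen2_0_X, nielsen2_0_Y, Li_1_X, Li_1_Y.
  pose proof (Li2_X_Y z hz).
  replace (Li 2 (X z)) with (- Li 2 (Y z) - 2 * z ^ 2) by lra. ring.
Qed.

(** The coefficient [A] of [coth z] in the derivative of the final formula. *)
Lemma nielsen2_2_X_add_Y : forall z, 0 < z ->
  nielsen2 2 (X z) + nielsen2 2 (Y z) - 2 * Li 4 (X z) - 2 * Li 4 (Y z)
  + 2 * z * (Li 3 (X z) - Li 3 (Y z)) + 2 * z ^ 4 / 3 = 0.
Proof.
  vanish.
  pose proof (Li2_X_Y z hz). pose proof (nielsen2_1_X_sub_Y z hz). pose proof (nielsen2_1_X_add_Y z hz).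
  replace (nielsen2 1 (X z)) with (nielsen2 1 (Y z) + 4 * z ^ 3 / 3) in * by lra.
  replace (nielsen2 1 (Y z)) with (Li 3 (X z) + Li 3 (Y z) - 2 * z ^ 3 / 3
     - z * (Li 2 (X z) - Li 2 (Y z))) by lra.
  replace (Li 2 (X z)) with (- Li 2 (Y z) - 2 * z ^ 2) by lra. field.
Qed.

(** Euler's reflection formula for [Li_2], as [w = 1 - y], combined with
    Landen's equation. *)
Lemma Li2_X_Y_W : forall z, 0 < z ->
  Li 2 (X z) - Li 2 (Y z) - 2 * Li 2 (W z) + 2 * zeta 2 - 2 * z ^ 2
  + 4 * (z * ln (2 * sinh z)) = 0.
Proof.
  vanish. rewrite Li_1_X, Li_1_Y, Li_1_W by trivial. ring.
Qed.

(** Landen's three-term equation for the trilogarithm. *)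
Lemma Li3_X_Y_W : forall z, 0 < z ->
  Li 3 (X z) + Li 3 (Y z) + Li 3 (W z) - zeta 3 + 2 * z * zeta 2 - 2 * z ^ 3 / 3
  + 2 * z * (z * ln (2 * sinh z)) = 0.
Proof.
  vanish.
  pose proof (Li2_X_Y z hz). pose proof (Li2_X_Y_W z hz).
  replace (Li 2 (W z)) with
    ((Li 2 (X z) - Li 2 (Y z)) / 2 + zeta 2 - z ^ 2 + 2 * (z * ln (2 * sinh z))) by lra.
  replace (Li 2 (X z)) with (- Li 2 (Y z) - 2 * z ^ 2) by lra. field.
Qed.

(** The part [B] of the derivative of the final formula that is free of [coth
    z]; its own derivative reduces to the trilogarithm equation. *)
Lemma nielsen2_2_X_sub_Y : forall z, 0 < z ->
  nielsen2 2 (X z) - nielsen2 2 (Y z) - 2 * Li 4 (W z)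
  + 2 * z * (Li 3 (X z) + Li 3 (Y z)) - 2 * z ^ 4 / 3
  + 8 * z ^ 2 / 3 * (z * ln (2 * sinh z)) + 2 * zeta 4 - 4 * z * zeta 3
  + 4 * z ^ 2 * zeta 2 = 0.
Proof.
  vanish.
  pose proof (Li2_X_Y z hz). pose proof (nielsen2_1_X_sub_Y z hz). pose proof (nielsen2_1_X_add_Y z hz). pose proof (Li3_X_Y_W z hz).
  replace (Li 3 (W z)) with
    (zeta 3 - Li 3 (X z) - Li 3 (Y z) - 2 * z * zeta 2 + 2 * z ^ 3 / 3
     - 2 * z * (z * ln (2 * sinh z))) by lra.
  replace (nielsen2 1 (X z)) with (nielsen2 1 (Y z) + 4 * z ^ 3 / 3) in * by lra.
  replace (nielsen2 1 (Y z)) with (Li 3 (X z) + Li 3 (Y z) - 2 * z ^ 3 / 3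
     - z * (Li 2 (X z) - Li 2 (Y z))) by lra.
  replace (Li 2 (X z)) with (- Li 2 (Y z) - 2 * z ^ 2) by lra. field.
Qed.

Lemma nielsen2_3_X_add_Y : forall z, 0 < z ->
  nielsen2 3 (X z) + nielsen2 3 (Y z) - (2 * Li 5 (X z) + 2 * Li 5 (Y z) - Li 5 (W z))
  + 2 * z * (Li 4 (X z) - Li 4 (Y z)) - 2 * z ^ 5 / 15
  + 2 * z ^ 3 / 3 * (z * ln (2 * sinh z)) - zeta 5 + 2 * z * zeta 4
  - 2 * z ^ 2 * zeta 3 + 4 * z ^ 3 / 3 * zeta 2 = 0.
Proof.
  vanish.
  pose proof (nielsen2_2_X_add_Y z hz). pose proof (nielsen2_2_X_sub_Y z hz).
  replace (Li 4 (W z)) with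
    ((nielsen2 2 (X z) - nielsen2 2 (Y z)) / 2
  + z * (Li 3 (X z) + Li 3 (Y z)) - z ^ 4 / 3
  + 4 * z ^ 2 / 3 * (z * ln (2 * sinh z)) + zeta 4 - 2 * z * zeta 3
  + 2 * z ^ 2 * zeta 2) by lra.
  replace (nielsen2 2 (X z)) with (- nielsen2 2 (Y z) + 2 * Li 4 (X z) + 2 * Li 4 (Y z)
  - 2 * z * (Li 3 (X z) - Li 3 (Y z)) - 2 * z ^ 4 / 3) by lra. field.
Qed.

Theorem lemma6p1 (z : R) (hz : 0 < z) :
  (nielsen 3 2 (RtoC (1 - exp (2 * z))) + nielsen 3 2 (RtoC (1 - exp (- 2 * z))) =
     (RtoC 2 * polylog 5 (RtoC (1 - exp (2 * z)))
      + RtoC 2 * polylog 5 (RtoC (1 - exp (- 2 * z)))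
      - polylog 5 (RtoC (exp (- 2 * z))))
     - RtoC (2 * z) * (polylog 4 (RtoC (1 - exp (2 * z)))
                       - polylog 4 (RtoC (1 - exp (- 2 * z))))
     + RtoC (2 * z ^ 5 / 15)
     - RtoC (2 * z ^ 4 / 3 * ln (2 * sinh z))
     + RtoC (zeta 5) - RtoC (2 * z * zeta 4) + RtoC (2 * z ^ 2 * zeta 3)
     - RtoC (4 * z ^ 3 / 3 * zeta 2))%C.
Proof.
  pose proof (nielsen2_3_X_add_Y z hz) as h.
  fold (X z) (Y z) (W z).
  rewrite !nielsen_RtoC, !polylog_RtoC by (apply X_lt_1 || apply Y_lt_1 || now apply W_lt_1).
  repeat (rewrite <- RtoC_plus || rewrite <- RtoC_minus || rewrite <- RtoC_mult).
  f_equal. lra.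
Qed.
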